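(* Let $p\in[1,\infty]$ and let $\alpha,\sigma\in\mathbb R$ be such that $\sigma>\alpha-1/p$ (with $1/\infty=0$). Let $h\in C^1([0,\infty))\cap L^\infty(\mathbb R_+)$ satisfy $h(0)=0$, $h'(0)>0$, $h(x)>0$ for all $x>0$ and $\liminf_{x\to\infty}h(x)>0$. If $h^\sigma D_\alpha u\in L^p(\mathbb R_+)$ and $h^{\sigma+1}u\in L^p(\mathbb R_+)$, then $h^\sigma u\in L^p(\mathbb R_+)$ and $$\|h^\sigma u\|_{L^p}\le C\big(\|h^\sigma D_\alpha u\|_{L^p}+\|h^{\sigma+1}u\|_{L^p}\big),$$ where $C$ does not depend on $u$.
   Context: $\mathbb R_+=(0,\infty)$. For $\alpha\in\mathbb R$, $D_\alpha u:=h\,\partial_xu+\alpha h'u=h^{1-\alpha}\partial_x(h^\alpha u)$, derivatives of the locally integrable function $u$ on $(0,\infty)$ being taken in the sense of distributions. *)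

(* Defs.v *)
From HB Require Import structures.
From mathcomp Require Import all_boot all_order all_algebra.
From mathcomp Require Import all_classical all_reals all_analysis.

Set Implicit Arguments.
Unset Strict Implicit.
Unset Printing Implicit Defensive.

Import Order.TTheory GRing.Theory Num.Theory.
Import numFieldNormedType.Exports.

Local Open Scope classical_set_scope.
Local Open Scope ring_scope.

(* Functions on (0, oo) or [0, oo) are represented by total functions R -> R;
   their values at the remaining points are never used. *)

Section HalfLine.
Context {R : realType}.
Implicit Types (u f h w phi : R -> R) (p : \bar R) (x s alpha : R).

Definition Rpos : set R := `]0, +oo[.

(* Difference quotients are restricted to [0, oo): the limit is the usual
   derivative for x > 0 and the right derivative for x = 0. *)
Definition half_dq h x : set_system R :=
  (fun y => (h y - h x) / (y - x)) @
    within [set y | 0 <= y /\ y != x] (nbhs x).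

Definition half_derive h x : R := lim (half_dq h x).

Definition C1_half h : Prop :=
  (forall x, 0 <= x -> cvg (half_dq h x)) /\
  {within `[0, +oo[, continuous (half_derive h)}.

Definition Lp_pos p f : Prop := f \_ Rpos \in Lfun (@lebesgue_measure R) p.

Definition Lp_norm_pos p f : \bar R :=
  'N[@lebesgue_measure R]_p[EFin \o (f \_ Rpos)]%E.

(* C_c^oo(0, oo), its elements being extended by 0 to R. *)
Definition test_function phi : Prop :=
  [/\ forall n x, derivable (derive1n n phi) x 1,
      compact (closure [set x | phi x != 0]) &
      closure [set x | phi x != 0] `<=` Rpos].

(* Distributions on (0, oo) are handled as functionals on all functions
   R -> R. Those arising here have order at most one, so that their values on
   the C^1 functions w * phi, with w of class C^1 and phi a test function, are
   meaningful; this is what gives sense to products by w. *)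
Definition functional : Type := (R -> R) -> R.

Definition distr_of u : functional := fun phi =>
  \int[@lebesgue_measure R]_(x in Rpos) (u x * phi x).

Definition distr_derive (T : functional) : functional := fun phi =>
  - T (derive1 phi).

Definition distr_mul w (T : functional) : functional := fun phi =>
  T (fun x => w x * phi x).

Definition distr_represents (T : functional) f : Prop :=
  forall phi, test_function phi -> T phi = distr_of f phi.

Definition Dalpha alpha h u : functional := fun phi =>
  distr_mul h (distr_derive (distr_of u)) phi +
  alpha * distr_mul (half_derive h) (distr_of u) phi.

End HalfLine.

(* Main.v *)
Require Import Defs.
From HB Require Import structures.
From mathcomp Require Import all_boot all_order all_algebra.
From mathcomp Require Import all_classical all_reals all_analysis.
From mathcomp Require Import measurable_realfun ess_sup_inf.
From mathcomp Require Import ring lra.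
Import Order.TTheory GRing.Theory Num.Theory.
Import numFieldNormedType.Exports.
Local Open Scope classical_set_scope.
Local Open Scope ring_scope.
Set Implicit Arguments.
Unset Strict Implicit.
Unset Printing Implicit Defensive.

(** Put beta = sigma - alpha, w = h^alpha u and v = h^sigma u = h^beta w, so that
    the hypothesis on the exponents reads beta > - 1/p. On (0, oo) the equation
    h^sigma D_alpha u = g means w' = h^(- beta - 1) g in the sense of
    distributions.

    Away from 0 there is nothing to prove: h is bounded below there, hence v is
    controlled by h v = h^(sigma + 1) u.

    Near 0 the estimate is a Hardy inequality. Fix d such that h' >= c0 > 0 on
    (0, d]. Integrating the equation from x up to a point y of [d/2, d] gives
      |v(x)| <= h(x)^beta |w(y)|
                + h(x)^beta \int_x^d h^(- beta - 1) |g|.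
    With kappa = beta + 1/p > 0, the first term is in L^p near 0, because
    h^(beta p) = h^(kappa p - 1) and h' >= c0; the second one is bounded in L^p
    by a multiple of the norm of g. All the weights in the proof are powers of h,
    and they are integrated through c0 h^(s - 1) <= (h^s)' / s, so that h is never
    compared with x. Finally |w(y)| is a bounded multiple of
    |h(y)^(sigma + 1) u(y)| for y in [d/2, d], and an average over such y (for p
    finite) or the choice of one such y (for p = oo) brings in the norm of
    h^(sigma + 1) u.

    To integrate the equation, observe that smooth test functions can be
    multiplied by h^sigma h but not, staying smooth, by h^(- beta - 1): h is only
    of class C^1. The weak formulation therefore says directly that
    W = h^(sigma + 1) u has the weak derivative K = g + (beta + 1) h' h^sigma u
    ([weak_formulation]). Testing it with a difference of two rescaled smooth
    steps, and shrinking the scale, yields W(y) - W(x) = \int_x^y K at all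
    Lebesgue points of W ([weak_derivative_pair]); the product rule for an
    indefinite integral times a C^1 function ([product_rule], which is Fubini's
    theorem on a triangle) turns this into the integrated equation for w
    ([ae_representation]).

    The Hardy inequality splits into a pointwise bound by a power mean
    inequality ([hardy_pointwise]) and an exchange of the integrals
    ([hardy_tonelli]); they are combined in [near_zero_Lp]. For p = oo the weight
    h^(- beta - 1) is integrated directly ([near_zero_Linfty]). *)

(** * Integrals of continuous functions and of derivatives *)

Section Preliminaries.
Context {R : realType}.
Notation mu := (@lebesgue_measure R).

Lemma gt0_powRD (x r s : R) : 0 < x -> x `^ (r + s) = x `^ r * x `^ s.
Proof. by move=> x0; rewrite powRD//; apply/implyP => _; rewrite gt_eqF. Qed.

Lemma integrable_addr (A : set R) (f g : R -> R) : measurable A ->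
  mu.-integrable A (EFin \o f) -> mu.-integrable A (EFin \o g) ->
  mu.-integrable A (EFin \o (fun x => f x + g x)).
Proof.
move=> mA fi gi.
by have := @integrableD _ (measurableTypeR R) R mu A mA _ _ fi gi.
Qed.

Lemma integrable_scale (A : set R) (k : R) (f : R -> R) : measurable A ->
  mu.-integrable A (EFin \o f) -> mu.-integrable A (EFin \o (fun x => k * f x)).
Proof.
by move=> mA fi; have := @integrableZl _ (measurableTypeR R) R mu A mA k _ fi.
Qed.

Lemma integrable_continuousM (a b : R) (f g : R -> R) :
  {within `[a, b], continuous g} -> mu.-integrable `[a, b] (EFin \o f) ->
  mu.-integrable `[a, b] (EFin \o (fun x => g x * f x)).
Proof.
move=> cg fi.
have mg : @measurable_fun _ _ (measurableTypeR R) R `[a, b] g.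
  exact: subspace_continuous_measurable_fun.
apply: (@integrableMr _ (measurableTypeR R) R mu `[a, b] _ g (EFin \o f)) => //.
have /compact_bounded : compact (g @` `[a, b]).
  by apply: continuous_compact => //; exact: segment_compact.
rewrite /bounded_set /bounded_near /=.
by apply: filterS => M /= H x xab; apply: H; exists x.
Qed.

Lemma integrable_Mcontinuous (a b : R) (f g : R -> R) :
  {within `[a, b], continuous g} -> mu.-integrable `[a, b] (EFin \o f) ->
  mu.-integrable `[a, b] (EFin \o (fun x => f x * g x)).
Proof.
move=> cg /(integrable_continuousM cg).
by rewrite (_ : (fun x => g x * f x) = (fun x => f x * g x))//; apply/funext => x;
  rewrite mulrC.
Qed.

Lemma integral_is_derive (a b : R) (F f : R -> R) : a <= b ->
  (forall x, a <= x <= b -> is_derive x (1 : R) F (f x)) ->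
  {within `[a, b], continuous f} ->
  (\int[mu]_(x in `[a, b]) (f x)%:E = (F b - F a)%:E)%E.
Proof.
rewrite le_eqVlt => /predU1P[->|ab] dF cf.
  by rewrite set_itv1 integral_set1 subrr.
have dx x : a <= x <= b -> derivable F x 1 by move=> /dF ?; exact: ex_derive.
have cx x : a <= x <= b -> F y @[y --> x] --> F x.
  by move=> xab; apply/differentiable_continuous/derivable1_diffP/dx.
apply: continuous_FTC2 => //.
- split.
  + by move=> x /[!in_itv]/= /andP[ax xb]; apply: dx; rewrite !ltW.
  + by apply: cvg_at_right_filter; apply: cx; rewrite lexx ltW.
  + by apply: cvg_at_left_filter; apply: cx; rewrite lexx ltW.
- move=> x /[!in_itv]/= /andP[ax xb]; rewrite derive1E.
  have ? : is_derive x (1 : R) F (f x) by apply: dF; rewrite !ltW.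
  by rewrite derive_val.
Qed.

End Preliminaries.

(** * A smooth step function *)

Section SmoothStep.
Context {R : realType}.
Implicit Types (f g : R -> R) (x : R) (n k : nat).

(** Differentiability of order n with the successive derivatives as witnesses:
    closure under sums, products and inverses then follows by induction on n,
    without any formula for higher derivatives. *)
Fixpoint diff_times n f : Prop :=
  if n is m.+1 then
    exists2 g, (forall x, is_derive x 1 f (g x)) & diff_times m g
  else True.

Lemma diff_timesW n f : diff_times n.+1 f -> diff_times n f.
Proof.
elim: n f => [//|n IH] f [g dg Hg]; exists g => //; exact: IH.
Qed.

Lemma diff_times_derivable n f : diff_times n.+1 f ->
  forall x, derivable (derive1n n f) x 1.
Proof.
elim: n f => [|n IH] f [g dg Hg] x; first by have ? := dg x; exact: ex_derive.
rewrite derive1Sn; suff -> : derive1 f = g by exact: IH.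
by apply/funext => y; rewrite derive1E derive_val.
Qed.

Lemma diff_timesD n f g : diff_times n f -> diff_times n g ->
  diff_times n (f \+ g).
Proof.
elim: n f g => [//|n IH] f g [f' df Hf] [g' dg Hg].
exists (f' \+ g') => [x|]; last exact: IH.
by have ? := dg x; have ? := df x; exact: is_deriveD.
Qed.

Lemma diff_timesM n f g : diff_times n f -> diff_times n g ->
  diff_times n (f \* g).
Proof.
elim: n f g => [//|n IH] f g [f' df Hf] [g' dg Hg].
exists ((f \* g') \+ (g \* f')) => [x|].
  by have ? := dg x; have ? := df x; exact: is_deriveM.
by apply: diff_timesD; apply: IH => //; apply: diff_timesW;
  [exists f'|exists g'].
Qed.

Lemma diff_times_cst n (c : R) : diff_times n (cst c).
Proof.
elim: n c => [//|n IH] c; exists (cst 0); last exact: IH.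
by move=> x; exact: is_derive_cst.
Qed.

(** The derivative - f' / f^2 of 1 / f involves 1 / f itself, which is why the
    induction carries the statement at the previous order. *)
Lemma diff_timesV n f : (forall x, f x != 0) -> diff_times n f ->
  diff_times n (fun x => (f x)^-1).
Proof.
move=> f0; elim: n => [//|n IH] [f' df Hf].
have Vf : diff_times n (fun x => (f x)^-1) by apply: IH; apply: diff_timesW; exists f'.
exists (fun x => (-1 * ((f x)^-1 * (f x)^-1)) * f' x) => [x|].
  have := df x => ?; apply: DeriveDef; first by apply: derivableV.
  rewrite deriveV// derive_val scaleNr; rewrite mulNr mul1r mulNr; congr (- (_ * _)).
  by rewrite expr2 invfM.
apply: diff_timesM => //; apply: diff_timesM; first exact: diff_times_cst.
exact: diff_timesM.
Qed.

Lemma diff_times_affine n f (a b : R) : diff_times n f ->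
  diff_times n (fun x => f (a * x + b)).
Proof.
elim: n f => [//|n IH] f [f' df Hf].
exists (fun x => a * f' (a * x + b)) => [x|].
  have d1 : is_derive x (1 : R) (fun x => a * x + b) a.
    have : is_derive x (1 : R) (a *: (id : R -> R) + cst b) (a *: 1 + 0)
      by exact: is_deriveD.
    by rewrite addr0 /GRing.scale /= mulr1.
  have := df (a * x + b) => d2.
  have := @is_derive1_comp _ f (fun x => a * x + b) x _ _ d2 d1.
  by rewrite mulrC.
by apply: diff_timesM; [exact: diff_times_cst|exact: IH].
Qed.

(** The functions x^(- k) exp (- 1 / x), extended by 0. Their linear span is
    stable under derivation, which is the reason for the parameter k. *)
Definition flat k x := if 0 < x then x^-1 ^+ k * expR (- x^-1) else 0.

(** The bound exp y >= y^(k+1) / (k+1)! at y = 1 / x. It is linear in x, so that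
    it also controls the difference quotients of [flat k] at 0, which are values
    of [flat k.+1]. *)
Lemma flat_le k x : `|flat k x| <= `|x| * k.+1`!%:R.
Proof.
rewrite /flat; case: ifPn => [x0|_]; last by rewrite normr0 mulr_ge0.
rewrite !gtr0_norm ?mulr_gt0 ?exprn_gt0 ?invr_gt0 ?expR_gt0//.
have y0 : 0 < x^-1 by rewrite invr_gt0.
have := expR_ge1Dxn k (ltW y0) => H.
rewrite expRN ler_pdivrMr ?expR_gt0//.
have fk : (0 : R) < k.+1`!%:R by rewrite ltr0n fact_gt0.
have -> : x^-1 ^+ k = x * (x^-1 ^+ k.+1 / k.+1`!%:R) * k.+1`!%:R.
  by rewrite mulrA mulfVK ?gt_eqF// exprS mulVKf// gt_eqF.
rewrite mulrAC ler_pM2l ?mulr_gt0//; apply: le_trans H.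
by rewrite lerDr.
Qed.

Lemma is_derive_flat k x :
  is_derive x (1 : R) (flat k) (flat k.+2 x + (- k%:R) * flat k.+1 x).
Proof.
have [x0|x0|->] := ltgtP x 0.
- have e : \forall y \near x, cst 0 y = flat k y.
    near=> y; rewrite /flat ltNge (_ : y <= 0)//=.
    by apply: ltW; near: y; exact: lt_nbhsl.
  apply: (near_eq_is_derive e).
  by rewrite /flat !ltNge (ltW x0)/= mulr0 addr0; exact: is_derive_cst.
- have e : \forall y \near x, (fun x => x^-1 ^+ k * expR (- x^-1)) y = flat k y.
    near=> y; rewrite /flat (_ : 0 < y)//.
    by near: y; exact: lt_nbhsr.
  apply: (near_eq_is_derive e).
  have xN0 : x != 0 by rewrite gt_eqF.
  have d1 : is_derive x (1 : R) (fun x => x^-1) (- x ^- 2).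
    apply: DeriveDef; first exact: derivableV.
    by rewrite deriveV// derive_val /= scaler1.
  have d2 : is_derive x (1 : R) (fun x => - x^-1) (x ^- 2).
    by have := @is_deriveN _ _ _ (fun x : R => x^-1) x 1 _ d1; rewrite opprK.
  have d3 : is_derive x (1 : R) (fun x => expR (- x^-1)) (expR (- x^-1) * x ^- 2).
    exact: is_derive1_comp.
  have d4 : is_derive x (1 : R) (fun x => x^-1 ^+ k) (k%:R * x^-1 ^+ k.-1 * - x ^- 2).
    have := @is_deriveX _ _ (fun x => x^-1) k x 1 _ d1.
    by rewrite /GRing.scale /= exprfctE.
  have := @is_deriveM _ _ (fun x => x^-1 ^+ k) (fun x => expR (- x^-1)) x 1 _ _ d4 d3.
  rewrite (_ : _ *: _ + _ = flat k.+2 x + 1 *- k * flat k.+1 x)//.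
  rewrite /flat x0 /GRing.scale /= -exprVn !expr2.
  case: k d4 {e} => [_|k _].
    by rewrite !exprS !expr0; ring.
  by rewrite !exprS; ring.
- rewrite /flat ltxx mulr0 addr0.
  have H : h^-1 *: (((flat k \o shift 0) (h *:
    (1:R))) - flat k 0) @[h --> 0^'] --> (0 : R).
    rewrite /= {2}/flat ltxx.
    apply/cvgr0Pnorm_le => e e0; near=> h.
    have h0 : h != 0 by near: h; exact: nbhs_dnbhs_neq.
    rewrite addr0 subr0 [h *: 1]mulr1.
    have -> : h^-1 *: flat k h = flat k.+1 h.
      rewrite /flat; case: ifPn => _; last by rewrite scaler0.
      by rewrite exprS -mulrA.
    apply: (le_trans (flat_le _ _)).
    rewrite -ler_pdivlMr ?ltr0n ?fact_gt0//.
    near: h; apply: dnbhs0_le.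
    by rewrite divr_gt0// ltr0n fact_gt0.
  apply: DeriveDef; first by apply/cvg_ex; exists 0; exact: H.
  by apply/cvg_lim; [exact: Rhausdorff|exact: H].
Unshelve. all: by end_near. Qed.

Lemma diff_times_flat n k : diff_times n (flat k).
Proof.
elim: n k => [//|n IH] k.
exists (fun x => flat k.+2 x + (- k%:R) * flat k.+1 x).
  by move=> x; exact: is_derive_flat.
by apply: diff_timesD => //; apply: diff_timesM => //; exact: diff_times_cst.
Qed.

Lemma flat_ge0 k x : 0 <= flat k x.
Proof.
rewrite /flat; case: ifPn => // x0.
by rewrite mulr_ge0 ?expR_ge0// exprn_ge0// invr_ge0 ltW.
Qed.

Lemma flat_gt0 k x : 0 < x -> 0 < flat k x.
Proof.
by move=> x0; rewrite /flat x0 mulr_gt0 ?expR_gt0// exprn_gt0// invr_gt0.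
Qed.

Lemma flat_le0 k x : x <= 0 -> flat k x = 0.
Proof. by move=> x0; rewrite /flat ltNge x0. Qed.

(** The values are 0 exactly up to 0 and 1 exactly from 1 on: rescaled around x
    on the right side only, the steps converge to the indicator of ]x, +oo[ at
    every point, x included. *)
Definition step x := flat 0 x / (flat 0 x + flat 0 (1 - x)).

Let den_gt0 x : 0 < flat 0 x + flat 0 (1 - x).
Proof.
have [x0|x0] := ltP 0 x; first by rewrite ltr_pwDl ?flat_gt0 ?flat_ge0.
by rewrite ltr_wpDl ?flat_gt0 ?flat_ge0 ?subr_gt0 ?(le_lt_trans x0).
Qed.

Lemma step_ge0 x : 0 <= step x.
Proof. by rewrite divr_ge0 ?flat_ge0// ltW. Qed.

Lemma step_le1 x : step x <= 1.
Proof. by rewrite ler_pdivrMr// mul1r lerDl flat_ge0. Qed.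

Lemma step_le0 x : x <= 0 -> step x = 0.
Proof. by move=> x0; rewrite /step flat_le0 ?mul0r. Qed.

Lemma step_ge1 x : 1 <= x -> step x = 1.
Proof.
move=> x1; rewrite /step [X in _ + X]flat_le0 ?subr_le0// addr0 divff//.
by rewrite gt_eqF// flat_gt0// (lt_le_trans _ x1).
Qed.

Lemma diff_times_step n : diff_times n step.
Proof.
apply: diff_timesM; first exact: diff_times_flat.
apply: diff_timesV => [x|]; first by rewrite gt_eqF.
apply: diff_timesD; first exact: diff_times_flat.
have := @diff_times_affine n (flat 0) (-1) 1 (diff_times_flat _ _).
by congr diff_times; apply/funext => x; rewrite mulN1r addrC.
Qed.

Lemma is_derive_step x : is_derive x (1 : R) step (derive1 step x).
Proof.
have [g dg _] := diff_times_step 1.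
by have := dg x => ?; rewrite derive1E derive_val.
Qed.

Lemma continuous_dstep : continuous (derive1 step : R -> R).
Proof.
have [g dg [g' dg' _]] := diff_times_step 2.
have -> : derive1 step = g by apply/funext => x; have := dg x => ?;
  rewrite derive1E derive_val.
move=> x; apply/differentiable_continuous/derivable1_diffP.
by have ? := dg' x; exact: ex_derive.
Qed.

Lemma dstep_out x : x < 0 \/ 1 < x -> derive1 step x = 0.
Proof.
move=> H; suff : exists c : R, \forall y \near x, cst c y = step y.
  move=> [c e]; have ? := near_eq_is_derive e (is_derive_cst c x 1).
  by rewrite derive1E derive_val.
case: H => H.
  exists 0; near=> y; rewrite /= step_le0// ltW//.
  by near: y; exact: lt_nbhsl.
exists 1; near=> y; rewrite /= step_ge1// ltW//.
by near: y; exact: lt_nbhsr.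
Unshelve. all: by end_near. Qed.

Lemma dstep_bounded : exists2 M : R, 0 <= M & forall x, `|derive1 step x| <= M.
Proof.
have : {within `[0, 1], continuous (fun x : R => `|derive1 step x|)}.
  apply: continuous_subspaceT => x; apply: cvg_norm; exact: continuous_dstep.
move=> /(EVT_max ler01)[c _ Hc].
exists `|derive1 step c|; first exact: normr_ge0.
move=> x.
have [|xo] := boolP (x \in `[0, 1]%R); first exact: Hc.
rewrite dstep_out ?normr0//.
by move: xo; rewrite in_itv/= negb_and -!ltNge => /orP[|]; [left|right].
Qed.

End SmoothStep.

(** * The product rule for indefinite integrals *)

Section ProductRule.
Context {R : realType}.
Notation mu := (@lebesgue_measure R).

Definition triangle_kernel (D K : R -> R) (z : R * R) : R :=
  if z.2 <= z.1 then D z.1 * K z.2 else 0.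

Lemma measurable_triangle_kernel (D K : R -> R) :
  measurable_fun setT D -> measurable_fun setT K ->
  measurable_fun setT (triangle_kernel D K).
Proof.
move=> mD mK; apply: measurable_fun_ifT => //=.
- by apply: measurable_fun_ler; [exact: measurable_snd|exact: measurable_fst].
- by apply: measurable_funM; [exact: measurableT_comp|exact: measurableT_comp].
Qed.

Lemma integrable_triangle_kernel (D K : R -> R) :
  mu.-integrable setT (EFin \o D) -> mu.-integrable setT (EFin \o K) ->
  (mu \x mu)%E.-integrable setT (EFin \o triangle_kernel D K).
Proof.
move=> iD iK.
have mD : measurable_fun setT D by have /measurable_int/measurable_EFinP := iD.
have mK : measurable_fun setT K by have /measurable_int/measurable_EFinP := iK.
apply/integrable12ltyP.
  by apply/measurable_EFinP; exact: measurable_triangle_kernel.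
move/integrableP : iD => [_ iD]; move/integrableP : iK => [_ iK].
have mm x : measurable_fun setT (fun y => `|(triangle_kernel D K (x, y))%:E|%E).
  apply/measurable_EFinP; apply: measurableT_comp => //.
  apply: (measurableT_comp (measurable_triangle_kernel mD mK)).
  exact: pair1_measurable.
apply: (@le_lt_trans _ _ (\int[mu]_x (`|(D x)%:E| * \int[mu]_y `|(K y)%:E|))%E).
  apply: ge0_le_integral => //.
  - by move=> x _; exact: integral_ge0.
  - apply: (measurable_fun_fubini_tonelli_F (m2 := mu)
      (fun z => `|(triangle_kernel D K z)%:E|%E)).
      by apply/measurable_EFinP; apply: measurableT_comp => //;
        exact: measurable_triangle_kernel.
    by [].
  - under eq_fun do rewrite muleC.
    apply: measurable_funeM.
    by apply/measurable_EFinP; exact: measurableT_comp.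
  - move=> x _; rewrite -ge0_integralZl//; last first.
      by apply/measurable_EFinP; exact: measurableT_comp.
    apply: ge0_le_integral => //.
    + exact: mm.
    + apply: measurable_funeM.
      by apply/measurable_EFinP; exact: measurableT_comp.
    + move=> y _; rewrite -EFinM lee_fin /triangle_kernel/=; case: ifPn => _.
        by rewrite normrM.
      by rewrite normr0 mulr_ge0.
rewrite ge0_integralZr//; last 2 first.
  by apply/measurable_EFinP; exact: measurableT_comp.
  exact: integral_ge0.
by apply: lte_mul_pinfty => //; [exact: integral_ge0|rewrite ge0_fin_numE//;
  exact: integral_ge0].
Qed.

(** The term with dpsi and the indefinite integral of K is an iterated integral
    over the triangle t <= x; exchanging the integrals turns it into the integral
    of K t * (psi b - psi t). No continuity of K is involved, which is what the
    weak derivative of a locally integrable function requires. *)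
Lemma product_rule (a b c : R) (K psi dpsi : R -> R) : a < b ->
  mu.-integrable `[a, b] (EFin \o K) ->
  (forall x, a <= x <= b -> is_derive x (1 : R) psi (dpsi x)) ->
  {within `[a, b], continuous dpsi} ->
  psi b * (c + \int[mu]_(x in `[a, b]) K x) - psi a * c =
  \int[mu]_(x in `[a, b])
    (psi x * K x + dpsi x * (c + \int[mu]_(t in `[a, x]) K t)).
Proof.
move=> ab iK dpsiP cdpsi.
have ftc s : a <= s <= b ->
    (\int[mu]_(x in `[s, b]) (dpsi x)%:E = (psi b - psi s)%:E)%E.
  move=> /andP[as_ sb]; apply: integral_is_derive => //.
    by move=> x /andP[sx xb]; apply: dpsiP; rewrite xb (le_trans as_).
  apply: continuous_subspaceW cdpsi => x /=; rewrite !in_itv/= => /andP[sx ->].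
  by rewrite (le_trans as_).
have cpsi : {within `[a, b], continuous psi}.
  by apply: derivable_within_continuous => x /[!in_itv]/= /dpsiP ?; exact: ex_derive.
have idpsi : mu.-integrable `[a, b] (EFin \o dpsi).
  by apply: continuous_compact_integrable => //; exact: segment_compact.
have mab : measurable (`[a, b] : set R) by exact: measurable_itv.
pose D := dpsi \_ `[a, b]; pose K' := K \_ `[a, b].
have iD : mu.-integrable setT (EFin \o D).
  by rewrite -restrict_EFin; apply/integrable_restrict => //; rewrite setTI.
have iK' : mu.-integrable setT (EFin \o K').
  by rewrite -restrict_EFin; apply/integrable_restrict => //; rewrite setTI.
have iW : {within `[a, b], continuous (fun x => \int[mu]_(t in `[a, x]) K t)}.
  by apply: parameterized_integral_continuous => //; exact: ltW.
have ipK : mu.-integrable `[a, b] (EFin \o (fun x => psi x * K x)).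
  exact: integrable_continuousM.
have idc : mu.-integrable `[a, b] (EFin \o (fun x => dpsi x * c)).
  by rewrite (_ : EFin \o _ = (fun x => (dpsi x)%:E * c%:E)%E)//; exact: integrableZr.
have idW : mu.-integrable `[a, b] (EFin \o (fun x =>
  dpsi x * \int[mu]_(t in `[a, x]) K t)).
  exact: integrable_Mcontinuous.
have -> : \int[mu]_(x in `[a, b])
    (psi x * K x + dpsi x * (c + \int[mu]_(t in `[a, x]) K t)) =
  \int[mu]_(x in `[a, b]) (psi x * K x) + \int[mu]_(x in `[a, b]) (dpsi x * c)
  + \int[mu]_(x in `[a, b]) (dpsi x * \int[mu]_(t in `[a, x]) K t).
  rewrite -RintegralD// -RintegralD//; last first.
    exact: integrable_addr.
  by apply: eq_Rintegral => x _; rewrite mulrDr addrA.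
have dE : \int[mu]_(x in `[a, b]) dpsi x = psi b - psi a.
  by rewrite /Rintegral ftc// lexx ltW.
rewrite RintegralZr// dE.
have FE : (\int[mu]_x \int[mu]_y (triangle_kernel D K' (x, y))%:E)%E =
    (\int[mu]_(x in `[a, b]) (dpsi x * \int[mu]_(t in `[a, x]) K t))%:E.
  rewrite fineK; last exact: integrable_fin_num.
  rewrite [RHS]integral_mkcond; apply: eq_integral => x _.
  rewrite patchE; case: ifPn => xab; last first.
    rewrite integral0_eq// => y _;
      rewrite /triangle_kernel/= /D patchE (negbTE xab) mul0r.
    by case: ifP.
  move: (xab); rewrite inE/= in_itv/= => /andP[ax xb].
  transitivity (\int[mu]_(y in `[a, x]) ((dpsi x)%:E * (K y)%:E))%E.
    rewrite [RHS]integral_mkcond; apply: eq_integral => y _.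
    rewrite patchE /triangle_kernel/= /D patchE xab /K' patchE mem_setE !in_itv/=
      mem_setE in_itv/=.
    have [yx|yx] := leP y x; last by rewrite andbF.
    by rewrite (le_trans yx xb) !andbT; case: ifP; rewrite ?mulr0.
  have iKx : mu.-integrable `[a, x] (EFin \o K).
    by apply: integrableS iK => //; apply: subset_itvl; rewrite bnd_simp.
  by rewrite integralZl//= EFinM fineK//; exact: integrable_fin_num.
have GE : (\int[mu]_y \int[mu]_x (triangle_kernel D K' (x, y))%:E)%E =
    (\int[mu]_(y in `[a, b]) (K y * (psi b - psi y)))%:E.
  have iKp : mu.-integrable `[a, b] (EFin \o (fun y => K y * (psi b - psi y))).
    apply: integrable_Mcontinuous => // x.
    by apply: cvgB; [exact: cvg_cst|exact: cpsi].
  rewrite fineK; last exact: integrable_fin_num.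
  rewrite [RHS]integral_mkcond; apply: eq_integral => y _.
  rewrite patchE; case: ifPn => yab; last first.
    rewrite integral0_eq// => x _;
      rewrite /triangle_kernel/= /K' patchE (negbTE yab) mulr0.
    by case: ifP.
  move: (yab); rewrite inE/= in_itv/= => /andP[ay yb].
  transitivity (\int[mu]_(x in `[y, b]) ((K y)%:E * (dpsi x)%:E))%E.
    rewrite [RHS]integral_mkcond; apply: eq_integral => x _.
    rewrite patchE /triangle_kernel/= /K' patchE yab /D patchE mem_setE !in_itv/=
      mem_setE in_itv/=.
    have [yx|yx] := leP y x; last by [].
    by rewrite (le_trans ay yx) /=; case: ifP; rewrite ?mul0r// mulrC.
  have idx : mu.-integrable `[y, b] (EFin \o dpsi).
    by apply: integrableS idpsi => //; apply: subset_itvr; rewrite bnd_simp.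
  rewrite integralZl//= EFinM; congr (_ * _)%E.
  by rewrite ftc// ay yb.
have := Fubini (integrable_triangle_kernel iD iK').
rewrite FE GE => -[->].
have -> : \int[mu]_(y in `[a, b]) (K y * (psi b - psi y)) =
   psi b * \int[mu]_(y in `[a, b]) K y - \int[mu]_(y in `[a, b]) (psi y * K y).
  rewrite -RintegralZl// -RintegralB//; last first.
    exact: integrable_scale.
  by apply: eq_Rintegral => x _; ring.
ring.
Qed.

End ProductRule.

(** * Limits of rescaled steps at Lebesgue points *)

Section StepLimits.
Context {R : realType}.
Notation mu := (@lebesgue_measure R).
Implicit Types (a b x y e : R).

Lemma is_derive_stepr x e t :
  is_derive t (1 : R) (fun t => step ((t - x) / e)) (derive1 step ((t - x) / e) / e).
Proof.
have d1 : is_derive t (1 : R) (fun t => (t - x) / e) e^-1.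
  have : is_derive t (1 : R) (e^-1 *: ((id : R -> R) - cst x)) (e^-1 *: (1 - 0)).
    exact: is_deriveZ.
  rewrite subr0 /GRing.scale /= mulr1.
  have -> // : e^-1 \*: ((id : R -> R) - cst x) = fun t => (t - x) / e.
  by apply/funext => z; rewrite mulrC.
have d2 := is_derive_step ((t - x) / e).
have := @is_derive1_comp _ step (fun t => (t - x) / e) t _ _ d2 d1.
by [].
Qed.

Lemma continuous_stepr x e : continuous (fun t => step ((t - x) / e)).
Proof.
move=> t; apply/differentiable_continuous/derivable1_diffP.
by have ? := is_derive_stepr x e t; exact: ex_derive.
Qed.

Lemma continuous_dstepr x e :
  continuous (fun t => derive1 step ((t - x) / e) / e).
Proof.
move=> t; apply: cvgMr_tmp.
apply: (@continuous_comp _ _ _ (fun t => (t - x) / e) (derive1 step)).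
  by apply: cvgMr_tmp; apply: cvgB; [exact: cvg_id|exact: cvg_cst].
exact: continuous_dstep.
Qed.

(** The rescaled derivative of the step is a kernel of mass 1 and height M / e
    supported in [x, x + e]; its error is at most a multiple of the mean
    deviation of W on the ball of radius 2 e, which tends to 0 at a Lebesgue
    point. *)
Lemma dstepr_approx a b x (W : R -> R) : a < x -> x < b ->
  mu.-integrable `[a, b] (EFin \o W) -> lebesgue_pt (W \_ `[a, b]) x ->
  (\int[mu]_(t in `[a, b])
     (W t * (derive1 step ((t - x) / n.+1%:R^-1) / n.+1%:R^-1))) @[n --> \oo] --> W x.
Proof.
move=> ax xb iW lW.
have mab : measurable (`[a, b] : set R) by exact: measurable_itv.
have [M M0 HM] := @dstep_bounded R.
pose e n : R := n.+1%:R^-1.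
have e0 n : 0 < e n by rewrite invr_gt0.
pose f := W \_ `[a, b].
pose k n t := derive1 step ((t - x) / e n) / e n.
have xab : x \in [set` `[a, b]] by rewrite inE/= in_itv/= !ltW.
have mf : @measurable_fun _ _ (measurableTypeR R) R setT f.
  have /measurable_int/measurable_EFinP mW := iW.
  by apply/(measurable_restrictT _ _).1.
have ck n : {within `[a, b], continuous (k n)}.
  by apply: continuous_subspaceT; exact: continuous_dstepr.
have iWk n : mu.-integrable `[a, b] (EFin \o (fun t => W t * k n t)).
  exact: integrable_Mcontinuous.
have ikn n : mu.-integrable `[a, b] (EFin \o k n).
  by apply: continuous_compact_integrable => //; exact: segment_compact.
have ick n : mu.-integrable `[a, b] (EFin \o (fun t => W x * k n t)).
  exact: integrable_scale.
(* The factor 4 M is the height M / e of the kernel times the length 4 e of the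
   ball. *)
have bound n : x + e n <= b ->
  (`|\int[mu]_(t in `[a, b]) (W t * k n t) - W x|%:E <=
    (4 * M)%:E * davg f x (2 * e n))%E.
  move=> xeb.
  have intk : \int[mu]_(t in `[a, b]) k n t = 1.
    have abl : a <= b by rewrite ltW// (lt_trans ax).
    have := @integral_is_derive _ a b (fun t => step ((t - x) / e n)) (k n)
      abl (fun t _ => is_derive_stepr x (e n) t) (ck n).
    rewrite /Rintegral => ->/=; rewrite step_ge1 ?step_le0 ?subr0//.
      by rewrite ler_pdivrMr// mul0r subr_le0 ltW.
    by rewrite ler_pdivlMr// mul1r lerBrDl.
  have -> : \int[mu]_(t in `[a, b]) (W t * k n t) - W x =
      \int[mu]_(t in `[a, b]) (W t * k n t - W x * k n t).
    by rewrite RintegralB// RintegralZl// intk mulr1.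
  have iF : mu.-integrable `[a, b] (EFin \o (fun t => W t * k n t - W x * k n t)).
    by have := @integrableB _ (measurableTypeR R) R mu _ mab _ _ (iWk n) (ick n).
  rewrite EFin_normr_Rintegral//.
  apply: (@le_trans _ _ (\int[mu]_(t in `[a, b]) `|(W t * k n t - W x * k n t)%:E|)%E).
    by apply: le_abse_integral => //; exact: (measurable_int mu).
  have mb : measurable (ball x (2 * e n)) by exact: measurable_ball.
  have mbf : @measurable_fun _ _ (measurableTypeR R) _ (ball x (2 * e n))
      (fun t => `|(f t - f x)%:E|%E).
    apply: measurableT_comp => //; apply/measurable_EFinP.
    by apply: measurable_funB => //; exact: measurable_funTS.
  have Me0 : 0 <= M / e n by rewrite divr_ge0// ltW.
  have -> : ((4 * M)%:E * davg f x (2 * e n) =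
     \int[mu]_(t in ball x (2 * e n)) ((M / e n)%:E * `|(f t - f x)%:E|))%E.
    rewrite ge0_integralZl//.
    rewrite /davg /iavg (lebesgue_measure_ball _ _) ?mulr_ge0 ?ltW//.
    rewrite inver gt_eqF ?pmulrn_lgt0 ?mulr_gt0//.
    rewrite muleA -EFinM; congr (_%:E * _)%E.
    have := e0 n; rewrite -mulr_natl; move: (e n) => ee ee0.
    by field; rewrite gt_eqF.
  rewrite integral_mkcond [leRHS]integral_mkcond.
  apply: ge0_le_integral => //.
  - by move=> t _; rewrite patchE; case: ifP.
  - apply/(measurable_restrictT _ _).1 => //.
    by apply: measurableT_comp => //; exact: (measurable_int mu).
  - by apply/(measurable_restrictT _ _).1 => //; exact: measurable_funeM.
  move=> t _; rewrite !patchE.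
  case: ifPn => [tab|_]; last first.
    by case: ifPn => // _; rewrite mule_ge0.
  case: ifPn => [tb|].
    rewrite -EFinM lee_fin -mulrBl normrM mulrC /f !patchE tab xab.
    rewrite ler_wpM2r// /k normrM [X in _ * X]gtr0_norm ?invr_gt0//.
    by rewrite ler_wpM2r// invr_ge0 ltW.
  rewrite notin_setE /ball/= => /negP; rewrite -leNgt => tb.
  suff -> : k n t = 0 by rewrite !mulr0 subrr normr0.
  rewrite /k dstep_out ?mul0r//.
  have [tx|tx] := ltP t x.
    by left; rewrite ltr_pdivrMr// mul0r subr_lt0.
  right; rewrite ltr_pdivlMr// mul1r.
  rewrite distrC ger0_norm ?subr_ge0// in tb.
  by apply: lt_le_trans tb; rewrite ltr_pMl// ltrDr.
have e2 : 2 * e n @[n --> \oo] --> (0 : R).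
  by rewrite -[0](mulr0 2); apply: cvgMl_tmp; exact: cvg_harmonic.
have D : (davg f x (2 * e n) @[n --> \oo] --> 0)%E.
  by apply: (cvge_at_rightP _ _ _).1 lW _ _; split=> // n; rewrite mulr_gt0.
have D2 : ((4 * M)%:E * davg f x (2 * e n) @[n --> \oo] --> 0)%E.
  by rewrite -[0%E](mule0 (4 * M)%:E); apply: cvgeZl.
apply/subr_cvg0; apply/norm_cvg0P.
suff : (`|\int[mu]_(t in `[a, b]) (W t * k n t) - W x|%:E @[n --> \oo] --> 0)%E.
  by move=> /fine_cvg.
apply: (squeeze_cvge _ (cvg_cst 0%E) D2).
near=> n; rewrite lee_fin normr_ge0/=; apply: bound.
rewrite -lerBrDl ltW//; near: n.
have : \forall z \near (0 : R), z < b - x.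
  by apply: lt_nbhsl; rewrite subr_gt0.
exact: cvg_harmonic.
Unshelve. all: by end_near. Qed.

Lemma stepr_indicator x t :
  step ((t - x) / n.+1%:R^-1) @[n --> \oo] --> (((x < t)%R)%:R : R).
Proof.
have [tx|tx] := leP t x.
  rewrite (_ : (fun n : nat => _) = cst 0); first exact: cvg_cst.
  by apply/funext => n; rewrite step_le0// ler_pdivrMr ?invr_gt0// mul0r subr_le0.
apply: (@cvg_trans _ ((cst (1 : R)) n @[n --> \oo])); last exact: cvg_cst.
apply: near_eq_cvg; near=> n; rewrite /= step_ge1//.
rewrite ler_pdivlMr ?invr_gt0// mul1r ltW//; near: n.
have : \forall z \near (0 : R), z < t - x by apply: lt_nbhsl; rewrite subr_gt0.
exact: (@cvg_harmonic R).
Unshelve. all: by end_near. Qed.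

(** The differences of steps tend to the indicator of ]x, y] and take values in
    [-1, 1], so that dominated convergence applies with the bound |K|. *)
Lemma stepr_approx a b x y (K : R -> R) : a < x -> x < y -> y < b ->
  mu.-integrable `[a, b] (EFin \o K) ->
  (\int[mu]_(t in `[a, b])
     (K t * (step ((t - x) / n.+1%:R^-1) - step ((t - y) / n.+1%:R^-1))))
    @[n --> \oo] --> \int[mu]_(t in `[x, y]) K t.
Proof.
move=> ax xy yb iK.
have mab : measurable (`[a, b] : set R) by exact: measurable_itv.
pose F n t := K t * (step ((t - x) / n.+1%:R^-1) - step ((t - y) / n.+1%:R^-1)).
pose G t := K t * ((x < t)%R%:R - (y < t)%R%:R).
have iF n : mu.-integrable `[a, b] (EFin \o F n).
  apply: integrable_Mcontinuous => //.
  by apply: continuous_subspaceT => t; apply: cvgB; exact: continuous_stepr.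
have mG : @measurable_fun _ _ (measurableTypeR R) _ `[a, b] (EFin \o G).
  apply/measurable_EFinP; apply: measurable_funM.
    by have /measurable_int/measurable_EFinP := iK.
  by apply: measurable_funB; apply: measurable_funTS;
    apply: measurableT_comp => //; exact: measurable_fun_ltr.
have cF : {ae mu, forall t, `[a, b]%classic t ->
    (EFin \o F n) t @[n --> \oo] --> (EFin \o G) t}.
  apply: aeW => t _; apply: cvg_EFin; first exact: nearW.
  by apply: cvgMl_tmp; apply: cvgB; exact: stepr_indicator.
have iaK : mu.-integrable `[a, b] (fun t => `|(K t)%:E|%E).
  exact: integrable_abse.
have dF : {ae mu, forall t n, `[a, b]%classic t ->
  (`|(EFin \o F n) t| <= `|(K t)%:E|)%E}.
  apply: aeW => t n _; rewrite lee_fin /F normrM ler_piMr//.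
  have := step_ge0 ((t - x) / n.+1%:R^-1); have := step_le1 ((t - x) / n.+1%:R^-1).
  have := step_ge0 ((t - y) / n.+1%:R^-1); have := step_le1 ((t - y) / n.+1%:R^-1).
  by move=> ? ? ? ?; rewrite ler_norml; apply/andP; split; lra.
have [iG _ H] := @dominated_convergence _ (measurableTypeR R) R mu _ mab _ _ _
  (fun n => measurable_int _ (iF n)) mG cF iaK dF.
have -> : \int[mu]_(t in `[x, y]) K t = \int[mu]_(t in `[a, b]) G t.
  rewrite -Rintegral_itv_obnd_cbnd; last first.
    by apply: integrableS iK => //; apply: subset_itv; rewrite bnd_simp ltW.
  rewrite Rintegral_mkcond [RHS]Rintegral_mkcond; apply: eq_Rintegral => t _.
  rewrite !patchE /G !mem_setE !in_itv/=.
  have [xt|tx] := ltP x t; have [yt|ty] := ltP y t => /=;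
    rewrite ?subrr ?subr0 ?mulr0 ?mulr1.
  - by case: ifP.
  - by rewrite (ltW (lt_trans ax xt)) (le_trans ty (ltW yb)).
  - by have := lt_trans xy (lt_le_trans yt tx); rewrite ltxx.
  - by case: ifP.
by apply: fine_cvg; rewrite /= fineK ?integrable_fin_num.
Qed.

End StepLimits.

(** * The weak formulation on the half-line *)

Section HalfLineCalculus.
Context {R : realType}.
Notation mu := (@lebesgue_measure R).
Implicit Types (h u g phi : R -> R) (x s alpha sigma : R).

Lemma open_Rpos : open (Rpos : set R).
Proof. by apply: interval_open. Qed.

Lemma measurable_Rpos : measurable (Rpos : set R).
Proof. exact: measurable_itv. Qed.

Lemma RposE x : (Rpos : set R) x = (0 < x).
Proof. by rewrite /Rpos/= in_itv/= andbT. Qed.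

Lemma itv_sub_Rpos (a b : R) : 0 < a -> `[a, b] `<=` (Rpos : set R).
Proof.
by move=> a0 x /=; rewrite RposE in_itv/= => /andP[ax _]; exact: lt_le_trans ax.
Qed.

(** At an interior point, the difference quotients restricted to the half-line
    are the usual ones. *)
Lemma is_derive_half h x : C1_half h -> 0 < x ->
  is_derive x (1 : R) h (half_derive h x).
Proof.
move=> [cq _] x0; have cx : half_dq h x --> half_derive h x := cq x (ltW x0).
have H : e^-1 *: ((h \o shift x) (e *: (1 : R)) - h x) @[e --> 0^'] --> half_derive h x.
  have cs : (e + x) @[e --> (0 : R)^'] --> within [set y | 0 <= y /\ y != x] (nbhs x).
    have c : (e + x) @[e --> (0 : R)^'] --> x.
      have c0 : (e + x) @[e --> (0 : R)] --> x.
        by rewrite -[X in _ --> X]add0r; apply: cvgD; [exact: cvg_id|exact: cvg_cst].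
      by move=> P /c0 HP; exact: nbhs_dnbhs HP.
    have D : \forall e \near (0 : R)^', 0 <= e + x /\ e + x != x.
      near=> e; split.
        rewrite -lerBlDr sub0r ltW//; near: e; apply: nbhs_dnbhs.
        by apply: lt_nbhsr; rewrite oppr_lt0.
      by rewrite -subr_eq0 addrK; near: e; exact: nbhs_dnbhs_neq.
    by move=> P /c /= HP; apply: filterS2 HP D => e; exact.
  have cx' : (h y - h x) / (y - x) @[y --> within [set y | 0 <= y /\ y != x] (nbhs x)]
    --> half_derive h x := cx.
  have := cvg_comp _ _ cs cx'.
  apply: cvg_trans; apply: near_eq_cvg; near=> e.
  by rewrite /= addrK [e *: 1]mulr1 mulrC.
apply: DeriveDef; first by apply/cvg_ex; exists (half_derive h x); exact: H.
by apply/cvg_lim; [exact: Rhausdorff|exact: H].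
Unshelve. all: by end_near. Qed.

Lemma continuous_half_derive h x : C1_half h -> 0 < x ->
  {for x, continuous (half_derive h)}.
Proof.
move=> [_ cd] x0; have : {within Rpos, continuous (half_derive h)}.
  apply: continuous_subspaceW cd => y; rewrite RposE /= in_itv/= andbT.
  exact: ltW.
rewrite (continuous_open_subspace _ open_Rpos).
by apply; rewrite inE RposE.
Qed.

Lemma is_derive_powR_comp (f : R -> R) x s df : 0 < f x ->
  is_derive x (1 : R) f df ->
  is_derive x (1 : R) (fun x => f x `^ s) (s * f x `^ (s - 1) * df).
Proof.
move=> fx0 dx.
have d2 : is_derive (f x) (1 : R) (fun y => y `^ s) (s * f x `^ (s - 1)).
  apply: DeriveDef; first by apply: derivable_powR; rewrite in_itv/= fx0.
  by rewrite -derive1E powR_derive1// in_itv/= fx0.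
have := @is_derive1_comp _ (fun y => y `^ s) f x _ _ d2 dx.
by [].
Qed.

Lemma continuous_powR_comp (f : R -> R) x s : 0 < f x ->
  {for x, continuous f} -> {for x, continuous (fun x => f x `^ s)}.
Proof.
move=> fx0 cf; apply: (@continuous_comp _ _ _ f (fun y => y `^ s)) => //.
apply/differentiable_continuous/derivable1_diffP.
by apply: derivable_powR; rewrite in_itv/= fx0.
Qed.

Lemma Rintegral_support (A B : set R) (f : R -> R) : A `<=` B ->
  (forall x, B x -> ~ A x -> f x = 0) ->
  \int[mu]_(x in B) f x = \int[mu]_(x in A) f x.
Proof.
move=> AB f0; rewrite Rintegral_mkcond [RHS]Rintegral_mkcond.
apply: eq_Rintegral => x _; rewrite !patchE.
have [xA|xA] := boolP (x \in A).
  by rewrite mem_set//; apply: AB; exact: set_mem.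
case: ifPn => // xB; rewrite f0//; first exact: set_mem.
by move: xA; rewrite notin_setE.
Qed.

Lemma locally_integrable_itv u (a b : R) : locally_integrable Rpos u -> 0 < a ->
  mu.-integrable `[a, b] (EFin \o u).
Proof.
move=> [mu_ _ lu] a0.
have sub := @itv_sub_Rpos a b a0.
apply/integrableP; split.
  apply/measurable_EFinP; apply: measurable_funS mu_ => //.
  exact: measurable_Rpos.
exact: (lu _ sub (@segment_compact _ _ _)).
Qed.

(** The derivative of h^(sigma + 1) phi produces h^(sigma + 1) phi' and
    (sigma + 1) h^sigma h' phi; grouping the second term with the term in alpha
    shows that h^(sigma + 1) u has the weak derivative
    g + (sigma + 1 - alpha) h' h^sigma u. *)
Lemma weak_formulation h alpha sigma u g phi dphi (a b : R) :
  C1_half h -> (forall x, 0 < x -> 0 < h x) -> 0 < a ->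
  locally_integrable Rpos u -> mu.-integrable `[a, b] (EFin \o g) ->
  test_function phi -> (forall x, is_derive x (1 : R) phi (dphi x)) ->
  continuous dphi ->
  (forall x, x \notin `[a, b] -> phi x = 0 /\ dphi x = 0) ->
  distr_represents
    (distr_mul (fun x => h x `^ sigma) (Dalpha alpha h u)) g ->
  \int[mu]_(x in `[a, b]) (h x `^ (sigma + 1) * u x * dphi x) +
  \int[mu]_(x in `[a, b]) ((g x + (sigma + 1 - alpha) *
    (half_derive h x * h x `^ sigma * u x)) * phi x) = 0.
Proof.
move=> C1h hpos a0 lu ig tphi dphiP cdphi phi0 /(_ phi tphi).
have dh x : 0 < x -> is_derive x (1 : R) h (half_derive h x).
  exact: is_derive_half.
have ch x : 0 < x -> {for x, continuous h}.
  move=> x0; apply/differentiable_continuous/derivable1_diffP.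
  by have ? := dh _ x0; exact: ex_derive.
have cphi : continuous phi.
  move=> x; apply/differentiable_continuous/derivable1_diffP.
  by have ? := dphiP x; exact: ex_derive.
have mab : measurable (`[a, b] : set R) by exact: measurable_itv.
have sub := @itv_sub_Rpos a b a0.
have cw (f : R -> R) : (forall x, 0 < x -> {for x, continuous f}) ->
    {within `[a, b], continuous f}.
  move=> cf; apply: continuous_in_subspaceT => x /set_mem /sub/=.
  by rewrite RposE; exact: cf.
rewrite /distr_mul /Dalpha /distr_mul /distr_derive /distr_of.
have iu := @locally_integrable_itv u a b lu a0.
pose V x := half_derive h x * h x `^ sigma * u x.
have iV : mu.-integrable `[a, b] (EFin \o V).
  apply: integrable_continuousM => //; apply: cw => x x0.
  apply: continuousM; first exact: continuous_half_derive.
  by apply: continuous_powR_comp; [exact: hpos|exact: ch].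
have iW : mu.-integrable `[a, b] (EFin \o (fun x => h x `^ (sigma + 1) * u x)).
  apply: integrable_continuousM => //; apply: cw => x x0.
  by apply: continuous_powR_comp; [exact: hpos|exact: ch].
have iVp : mu.-integrable `[a, b] (EFin \o (fun x => V x * phi x)).
  by apply: integrable_Mcontinuous => //; apply: cw => x _; exact: cphi.
have igp : mu.-integrable `[a, b] (EFin \o (fun x => g x * phi x)).
  by apply: integrable_Mcontinuous => //; apply: cw => x _; exact: cphi.
have iWp : mu.-integrable `[a, b]
    (EFin \o (fun x => h x `^ (sigma + 1) * u x * dphi x)).
  by apply: integrable_Mcontinuous => //; apply: cw => x _; exact: cdphi.
have nab x : ~ `[a, b]%classic x -> phi x = 0 /\ dphi x = 0.
  by move=> nx; apply: phi0; apply/negP.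
have d1 x : 0 < x -> derive1 (fun x => h x * (h x `^ sigma * phi x)) x =
    (sigma + 1) * (half_derive h x * h x `^ sigma) * phi x +
    h x `^ (sigma + 1) * dphi x.
  move=> x0; have hx0 := hpos _ x0.
  have dhx := dh _ x0; have dpx := dphiP x.
  have dsx := is_derive_powR_comp sigma hx0 dhx.
  have dm := @is_deriveM _ _ (fun x => h x `^ sigma) phi x 1 _ _ dsx dpx.
  have dmm := @is_deriveM _ _ h (fun x => h x `^ sigma * phi x) x 1 _ _ dhx dm.
  rewrite derive1E; have -> := @derive_val _ _ _ _ _ _ _ dmm.
  rewrite /GRing.scale /=.
  have -> : h x `^ (sigma + 1) = h x `^ sigma * h x.
    by rewrite gt0_powRD// powRr1 ?ltW.
  have : h x * h x `^ (sigma - 1) = h x `^ sigma.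
    by rewrite -{1}(powRr1 (ltW hx0)) -gt0_powRD// addrCA subrr addr0.
  move: (h x `^ (sigma - 1)) (h x `^ sigma) => A B AB.
  by rewrite -AB; ring.
rewrite (Rintegral_support sub); last first.
  move=> x; rewrite RposE => x0 /nab[p0 dp0].
  by rewrite d1// p0 dp0 !mulr0 addr0 mulr0.
rewrite (Rintegral_support sub); last first.
  by move=> x _ /nab[-> _]; rewrite !mulr0.
rewrite (Rintegral_support sub); last first.
  by move=> x _ /nab[-> _]; rewrite !mulr0.
have -> : \int[mu]_(x in `[a, b])
      (u x * (fun x => h x * (h x `^ sigma * phi x))^`()%classic x) =
    (sigma + 1) * \int[mu]_(x in `[a, b]) (V x * phi x) +
    \int[mu]_(x in `[a, b]) (h x `^ (sigma + 1) * u x * dphi x).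
  rewrite -RintegralZl// -RintegralD//; last exact: integrable_scale.
  apply: eq_Rintegral => x /set_mem/sub; rewrite RposE => x0.
  by rewrite d1// /V; ring.
have -> : \int[mu]_(x in `[a, b]) (u x * (half_derive h x * (h x `^ sigma * phi x))) =
    \int[mu]_(x in `[a, b]) (V x * phi x).
  by apply: eq_Rintegral => x _; rewrite /V; ring.
have -> : \int[mu]_(x in `[a, b]) ((g x + (sigma + 1 - alpha) * V x) * phi x) =
    \int[mu]_(x in `[a, b]) (g x * phi x) +
    (sigma + 1 - alpha) * \int[mu]_(x in `[a, b]) (V x * phi x).
  rewrite -RintegralZl// -RintegralD//; last exact: integrable_scale.
  by apply: eq_Rintegral => x _; ring.
by move=> <-; ring.
Qed.

End HalfLineCalculus.

(** * The integrated equation *)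

Section Representation.
Context {R : realType}.
Notation mu := (@lebesgue_measure R).
Implicit Types (h u g : R -> R) (x y e alpha sigma : R).

Lemma test_function_step x y e : 0 < e -> 0 < x -> x < y ->
  test_function (fun t => step ((t - x) / e) - step ((t - y) / e)).
Proof.
move=> e0 x0 xy; set phi := fun t => _.
have sub : closure [set t | phi t != 0] `<=` `[x, y + e].
  have /closure_id -> : closed `[x, y + e]%classic by exact: interval_closed.
  apply: closure_subset => t /=; rewrite in_itv/= => /negP pt.
  apply/andP; split; rewrite leNgt; apply/negP => tl; apply: pt; apply/eqP.
    rewrite /phi !step_le0 ?subrr// ler_pdivrMr// mul0r subr_le0 ltW//.
    exact: lt_trans xy.
  rewrite /phi !step_ge1 ?subrr// ler_pdivlMr// mul1r lerBrDl ltW//.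
  by apply: lt_trans tl; rewrite ltrD2r.
split.
- move=> n t; apply: diff_times_derivable.
  have ds z : diff_times n.+1 (fun t => step ((t - z) / e)).
    have := @diff_times_affine _ n.+1 step e^-1 (- z / e) (diff_times_step _).
    by congr diff_times; apply/funext => s; rewrite mulrBl [e^-1 * _]mulrC mulNr.
  have -> : phi = (fun t => step ((t - x) / e)) \+ (cst (-1) \* (fun t => step
    ((t - y) / e))).
    by apply/funext => s /=; rewrite mulN1r.
  by apply: diff_timesD => //; apply: diff_timesM => //; exact: diff_times_cst.
- by apply: subclosed_compact sub; [exact: closed_closure|exact: segment_compact].
- by apply: (subset_trans sub); exact: itv_sub_Rpos.
Qed.

(** The test functions are differences of two steps at the scale 1 / (n + 1),
    one starting at x and one at y; they are supported in [a, b] as soon as the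
    second step ends before b. *)
Lemma weak_derivative_pair h alpha sigma u g x y (a b : R) :
  C1_half h -> (forall x, 0 < x -> 0 < h x) -> 0 < a -> a < x -> x < y -> y < b ->
  locally_integrable Rpos u -> mu.-integrable `[a, b] (EFin \o g) ->
  distr_represents
    (distr_mul (fun x => h x `^ sigma) (Dalpha alpha h u)) g ->
  let W t := h t `^ (sigma + 1) * u t in
  let K t := g t + (sigma + 1 - alpha) *
    (half_derive h t * h t `^ sigma * u t) in
  mu.-integrable `[a, b] (EFin \o W) ->
  mu.-integrable `[a, b] (EFin \o K) ->
  lebesgue_pt (W \_ `[a, b]) x -> lebesgue_pt (W \_ `[a, b]) y ->
  W y - W x = \int[mu]_(t in `[x, y]) K t.
Proof.
move=> C1h hpos a0 ax xy yb lu ig rep W K iW iK lx ly.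
have mab : measurable (`[a, b] : set R) by exact: measurable_itv.
pose e n : R := n.+1%:R^-1.
have e0 n : 0 < e n by rewrite invr_gt0.
pose k z n t := derive1 step ((t - z) / e n) / e n.
have iWk z n : mu.-integrable `[a, b] (EFin \o (fun t => W t * k z n t)).
  apply: integrable_Mcontinuous => //; apply: continuous_subspaceT.
  exact: continuous_dstepr.
pose I n := \int[mu]_(t in `[a, b]) (W t * k x n t) -
  \int[mu]_(t in `[a, b]) (W t * k y n t) +
  \int[mu]_(t in `[a, b]) (K t * (step ((t - x) / e n) - step ((t - y) / e n))).
have cI : I n @[n --> \oo] --> W x - W y + \int[mu]_(t in `[x, y]) K t.
  apply: cvgD; last exact: stepr_approx.
  by apply: cvgB; apply: dstepr_approx => //; [exact: lt_trans yb|exact: lt_trans xy].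
have I0 : \forall n \near \oo, cst 0 n = I n.
  near=> n.
  have yeb : y + e n < b.
    rewrite -ltrBrDl; near: n.
    have : \forall z \near (0 : R), z < b - y by apply: lt_nbhsl; rewrite subr_gt0.
    exact: (@cvg_harmonic R).
  pose phi t := step ((t - x) / e n) - step ((t - y) / e n).
  pose dphi t := k x n t - k y n t.
  have tphi : test_function phi.
    by apply: test_function_step => //; exact: lt_trans ax.
  have dphiP t : is_derive t (1 : R) phi (dphi t).
    by apply: is_deriveB; exact: is_derive_stepr.
  have cdphi : continuous dphi.
    by move=> t; apply: cvgB; exact: continuous_dstepr.
  have phi0 t : t \notin `[a, b] -> phi t = 0 /\ dphi t = 0.
    rewrite in_itv/= negb_and -!ltNge => /orP[ta|bt].
      have tx : t < x by exact: lt_trans ax.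
      have ty : t < y by exact: lt_trans xy.
      rewrite /phi /dphi /k !dstep_out; [|left|left];
        rewrite ?ltr_pdivrMr// ?mul0r ?subr_lt0//.
      by rewrite !step_le0 ?subrr// ler_pdivrMr// mul0r subr_le0 ltW.
    have ty : y + e n < t by exact: lt_trans bt.
    have tx : x + e n < t by apply: lt_trans ty; rewrite ltrD2r.
    rewrite /phi /dphi /k !dstep_out; [|right|right];
      rewrite ?ltr_pdivlMr// ?mul1r ?ltrBrDl//.
    by rewrite !mul0r !step_ge1 ?subrr// ler_pdivlMr// mul1r lerBrDl ltW.
  rewrite /= -(weak_formulation C1h hpos a0 lu ig tphi dphiP cdphi phi0 rep).
  congr (_ + _); rewrite -RintegralB//; apply: eq_Rintegral => t _.
  by rewrite /dphi mulrBr.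
have cI0 : I n @[n --> \oo] --> (0 : R).
  apply: (@cvg_trans _ ((cst (0 : R)) n @[n --> \oo])); last exact: cvg_cst.
  exact: near_eq_cvg.
have : W x - W y + \int[mu]_(t in `[x, y]) K t = 0.
  exact: (cvg_unique (@Rhausdorff R) cI cI0).
by move=> H; lra.
Unshelve. all: by end_near. Qed.

(** Lebesgue points of a function that is only locally integrable on (0, oo):
    the truncations to [1 / (n + 1), n + 1] are integrable, and two given points
    are interior to one of these intervals. *)
Definition good_pt (W : R -> R) x := forall n : nat,
  n.+1%:R^-1 < x < n.+1%:R -> lebesgue_pt (W \_ `[n.+1%:R^-1, n.+1%:R]) x.

Lemma ae_good_pt (W : R -> R) :
  (forall a b, 0 < a -> mu.-integrable `[a, b] (EFin \o W)) ->
  {ae mu, forall x, good_pt W x}.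
Proof.
move=> iW.
have H (n : nat) : {ae mu, forall x, lebesgue_pt (W \_ `[n.+1%:R^-1, n.+1%:R]) x}.
  apply: lebesgue_differentiation; apply: integrable_locally.
    exact: measurable_itv.
  by apply: iW; rewrite invr_gt0.
by apply: filterS (ae_foralln H) => x Hx n _; exact: Hx.
Qed.

(** Multiplying W = h^(sigma + 1) u by psi = h^(- gam), gam = sigma + 1 - alpha,
    cancels the part of the weak derivative of W that contains u. The product
    rule is applied to the continuous representative of W, which agrees with W at
    almost every point. *)
Lemma ae_representation h alpha sigma u g :
  C1_half h -> (forall x, 0 < x -> 0 < h x) ->
  locally_integrable Rpos u ->
  (forall a b, 0 < a -> mu.-integrable `[a, b] (EFin \o g)) ->
  distr_represents
    (distr_mul (fun x => h x `^ sigma) (Dalpha alpha h u)) g ->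
  exists2 E : set R, {ae mu, forall x, E x} &
    forall x y, 0 < x -> x < y -> E x -> E y ->
    h y `^ alpha * u y - h x `^ alpha * u x =
      \int[mu]_(t in `[x, y]) (h t `^ (alpha - sigma - 1) * g t).
Proof.
move=> C1h hpos lu ig rep.
pose W t := h t `^ (sigma + 1) * u t.
pose K t := g t + (sigma + 1 - alpha) * (half_derive h t * h t `^ sigma * u t).
have dh x : 0 < x -> is_derive x (1 : R) h (half_derive h x).
  exact: is_derive_half.
have ch x : 0 < x -> {for x, continuous h}.
  move=> x0; apply/differentiable_continuous/derivable1_diffP.
  by have ? := dh _ x0; exact: ex_derive.
have cw (f : R -> R) a b : 0 < a -> (forall x, 0 < x -> {for x, continuous f}) ->
    {within `[a, b], continuous f}.
  move=> a0 cf; apply: continuous_in_subspaceT => x /set_mem /(itv_sub_Rpos a0).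
  by rewrite RposE; exact: cf.
have ciW a b : 0 < a -> mu.-integrable `[a, b] (EFin \o W).
  move=> a0; apply: integrable_continuousM; last exact: locally_integrable_itv.
  by apply: cw => // x x0; apply: continuous_powR_comp; [exact: hpos|exact: ch].
have ciK a b : 0 < a -> mu.-integrable `[a, b] (EFin \o K).
  move=> a0; apply: integrable_addr => //; first exact: ig.
  apply: integrable_scale => //.
  apply: integrable_continuousM; last exact: locally_integrable_itv.
  apply: cw => // x x0; apply: continuousM; first exact: continuous_half_derive.
  by apply: continuous_powR_comp; [exact: hpos|exact: ch].
exists (good_pt W); first exact: ae_good_pt.
have pair x y : 0 < x -> x < y -> good_pt W x -> good_pt W y ->
    W y - W x = \int[mu]_(t in `[x, y]) K t.
  move=> x0 xy gx gy; have y0 := lt_trans x0 xy.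
  have [n [nx yn]] : exists n : nat, n.+1%:R^-1 < x /\ y < n.+1%:R.
    (* An index n with 1 / (n + 1) < x and y < n + 1. *)
    pose m := Num.truncn (Num.max x^-1 y); exists m.
    have : Num.max x^-1 y < m.+1%:R.
      by rewrite truncnS_gt.
    rewrite gt_max => /andP[xm ym]; split => //.
    by rewrite -[ltRHS]invrK ltf_pV2 ?posrE ?invr_gt0.
  apply: (@weak_derivative_pair h alpha sigma u g x y n.+1%:R^-1 n.+1%:R) => //.
  - exact: ig.
  - exact: ciW.
  - exact: ciK.
  - by apply: gx; rewrite nx (lt_trans xy).
  - by apply: gy; rewrite yn (lt_trans nx).
move=> x y x0 xy gx gy; have y0 := lt_trans x0 xy.
pose gam := sigma + 1 - alpha.
pose psi t := h t `^ (- gam).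
pose dpsi t := - gam * h t `^ (- gam - 1) * half_derive h t.
have psiW t : 0 < t -> h t `^ alpha * u t = psi t * W t.
  move=> t0; rewrite /psi /W mulrA -gt0_powRD ?hpos//.
  by congr (_ `^ _ * _); rewrite /gam; ring.
rewrite !psiW//.
have cdpsi : {within `[x, y], continuous dpsi}.
  apply: cw => // t t0; apply: continuousM; last exact: continuous_half_derive.
  apply: continuousM; first exact: cvg_cst.
  by apply: continuous_powR_comp; [exact: hpos|exact: ch].
have cpsi : {within `[x, y], continuous psi}.
  by apply: cw => // t t0; apply: continuous_powR_comp; [exact: hpos|exact: ch].
have dpsiP t : x <= t <= y -> is_derive t (1 : R) psi (dpsi t).
  move=> /andP[xt _]; have t0 : 0 < t by exact: lt_le_trans xt.
  by apply: is_derive_powR_comp; [exact: hpos|exact: dh].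
have PR := product_rule (W x) xy (ciK x y x0) dpsiP cdpsi.
rewrite -(pair x y)// addrCA subrr addr0 in PR.
rewrite PR /Rintegral; congr fine.
have mxy : measurable (`[x, y] : set R) by exact: measurable_itv.
apply: (@ae_eq_integral _ (measurableTypeR R) R mu) => //.
- apply/measurable_EFinP; apply: measurable_funD.
    have /measurable_int/measurable_EFinP := integrable_continuousM cpsi (ciK x y x0).
    by [].
  have cI : {within `[x, y], continuous (fun t => W x + \int[mu]_(s in `[x, t]) K s)}.
    move=> t; apply: cvgD; first exact: cvg_cst.
    by apply: parameterized_integral_continuous; [exact: ltW|exact: ciK].
  apply: measurable_funM.
    exact: subspace_continuous_measurable_fun.
  exact: subspace_continuous_measurable_fun.
- have := integrable_continuousM cpsi (ig x y x0) => /measurable_int.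
  rewrite (_ : (fun t => psi t * g t) = (fun t => h t `^ (alpha - sigma - 1) * g t))//.
  by apply/funext => t; rewrite /psi; congr (_ `^ _ * _); rewrite /gam; ring.
have := ae_good_pt ciW; apply: filterS; first exact: (ae_filter_ringOfSetsType mu).
move=> t gt; rewrite /= in_itv/= => /andP[xt ty].
have t0 : 0 < t by exact: lt_le_trans xt.
have -> : W x + \int[mu]_(s in `[x, t]) K s = W t.
  move: xt; rewrite le_eqVlt => /predU1P[->|xt].
    by rewrite set_itv1 Rintegral_set1 addr0.
  by rewrite -pair// addrCA subrr addr0.
congr (_%:E); rewrite /psi /dpsi /K /W -/gam.
have -> : alpha - sigma - 1 = - gam by rewrite /gam; ring.
have ht0 := hpos _ t0.
have -> : h t `^ (sigma + 1) = h t `^ sigma * h t by rewrite gt0_powRD// powRr1 ?ltW.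
have : h t `^ (- gam - 1) * h t = h t `^ (- gam).
  by rewrite -{2}(powRr1 (ltW ht0)) -gt0_powRD// subrK.
move=> <-; ring.
Qed.

End Representation.

(** * Power means and integrals over a triangle *)

Section Hardy.
Context {R : realType}.
Notation mu := (@lebesgue_measure R).
Local Notation borel := (measurableTypeR R).

(** Young's inequality for t and s^(p - 1); equivalently, the graph of t^p lies
    above its tangent at s. *)
Lemma powR_tangent (p s t : R) : 1 <= p -> 0 <= s -> 0 <= t ->
  p * s `^ (p - 1) * t <= t `^ p + (p - 1) * s `^ p.
Proof.
rewrite le_eqVlt => /predU1P[<-|p1] s0 t0.
  by rewrite subrr powRr0 !mul1r powRr1// mul0r addr0.
have p0 : 0 < p by exact: lt_trans p1.
have pN0 : p != 0 by rewrite gt_eqF.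
have q0 : 0 < p / (p - 1) by rewrite divr_gt0// subr_gt0.
have := @conjugate_powR R t (s `^ (p - 1)) p (p / (p - 1)) t0 (powR_ge0 _ _) p0 q0.
rewrite -powRrM mulrCA divff ?subr_eq0 ?gt_eqF// mulr1 => H.
have {H} := H _; rewrite -(ler_pM2l p0) => H.
have -> : p * s `^ (p - 1) * t = p * (t * s `^ (p - 1)) by ring.
apply: (le_trans (H _)).
  by field; rewrite pN0 subr_eq0 gt_eqF.
rewrite le_eqVlt; apply/orP; left; apply/eqP; field.
by rewrite pN0 subr_eq0 gt_eqF.
Qed.

Lemma powRD_le (p a b : R) : 0 <= p -> 0 <= a -> 0 <= b ->
  (a + b) `^ p <= 2 `^ p * (a `^ p + b `^ p).
Proof.
move=> p0 a0 b0; wlog ab : a b a0 b0 / a <= b.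
  move=> H; have [/H|/ltW/H] := leP a b; first exact.
  by rewrite addrC [X in _ <= _ * X]addrC; exact.
apply: (@le_trans _ _ ((2 * b) `^ p)).
  apply: ge0_ler_powR => //; rewrite ?nnegrE ?addr_ge0 ?mulr_ge0//.
  by rewrite mulr_natl mulr2n lerD2r.
by rewrite powRM// ler_wpM2l ?powR_ge0// lerDr powR_ge0.
Qed.

(** Jensen's inequality for the measure with density m: integrate the tangent
    inequality at s = J / M. Only a lower bound J of the integral of F m and an
    upper bound M of the mass enter, so that no integral has to be finite or
    computed exactly. *)
Lemma power_mean (A : set borel) (m F : R -> R) (p M J : R) : measurable A ->
  measurable_fun A m -> measurable_fun A F ->
  (forall x, A x -> 0 <= m x) -> (forall x, A x -> 0 <= F x) ->
  1 <= p -> 0 < M -> (\int[mu]_(x in A) (m x)%:E <= M%:E)%E ->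
  0 <= J -> (J%:E <= \int[mu]_(x in A) (F x * m x)%:E)%E ->
  ((J `^ p)%:E <= (M `^ (p - 1))%:E * \int[mu]_(x in A) (F x `^ p * m x)%:E)%E.
Proof.
move=> mA mm mF m0 F0 p1 M0 mM J0 JF.
have p0 : 0 < p by exact: lt_le_trans p1.
(* The point of tangency that makes the two sides balance. *)
pose s := J / M.
have s0 : 0 <= s by rewrite divr_ge0// ltW.
have mFp : measurable_fun A (fun x => F x `^ p).
  exact: (measurableT_comp (measurable_powR p)).
have step1 : ((p * s `^ (p - 1))%:E * \int[mu]_(x in A) (F x * m x)%:E <=
   \int[mu]_(x in A) (F x `^ p * m x)%:E +
   ((p - 1) * s `^ p)%:E * \int[mu]_(x in A) (m x)%:E)%E.
  have mFm : measurable_fun A (fun x => (F x * m x)%:E).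
    by apply/measurable_EFinP; exact: measurable_funM.
  have mFpm : measurable_fun A (fun x => (F x `^ p * m x)%:E).
    by apply/measurable_EFinP; exact: measurable_funM.
  have mme : measurable_fun A (fun x => (m x)%:E) by exact/measurable_EFinP.
  have pp : 0 <= p * s `^ (p - 1) by rewrite mulr_ge0 ?powR_ge0// ltW.
  have qq : 0 <= (p - 1) * s `^ p by rewrite mulr_ge0 ?powR_ge0 ?subr_ge0.
  rewrite -ge0_integralZl//; last by move=> x Ax; rewrite lee_fin mulr_ge0 ?F0 ?m0.
  rewrite -ge0_integralZl//.
  rewrite -ge0_integralD//; last 3 first.
  - by move=> x Ax; rewrite lee_fin mulr_ge0 ?powR_ge0 ?m0.
  - by move=> x Ax; rewrite -EFinM lee_fin mulr_ge0// m0.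
  - exact: measurable_funeM.
  apply: ge0_le_integral => //.
  - by move=> x Ax; rewrite -EFinM lee_fin mulr_ge0// mulr_ge0 ?F0 ?m0.
  - exact: measurable_funeM.
  - by apply: emeasurable_funD => //; exact: measurable_funeM.
  move=> x Ax; rewrite -!EFinM -EFinD lee_fin mulrA -mulrDl.
  by apply: ler_wpM2r; [exact: m0|apply: powR_tangent => //; exact: F0].
have : ((p * s `^ (p - 1) * J)%:E <=
    \int[mu]_(x in A) (F x `^ p * m x)%:E + ((p - 1) * s `^ (p - 1) * J)%:E)%E.
  apply: le_trans.
    rewrite EFinM; apply: lee_wpmul2l JF.
    by rewrite lee_fin mulr_ge0 ?powR_ge0// ltW.
  apply: (le_trans step1); apply: leeD2l.
  have -> : (p - 1) * s `^ (p - 1) * J = (p - 1) * s `^ p * M.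
    rewrite -(@mulr_powRB1 _ s p)// /s; move: (_ `^ _) => q; field.
    by rewrite gt_eqF.
  by rewrite [leRHS]EFinM lee_wpmul2l// lee_fin mulr_ge0 ?powR_ge0 ?subr_ge0.
rewrite -leeBlDr// -EFinB.
have -> : p * s `^ (p - 1) * J - (p - 1) * s `^ (p - 1) * J = s `^ (p - 1) * J by ring.
have Mp0 : 0 < M `^ (p - 1) by exact: powR_gt0.
have -> : (J `^ p = M `^ (p - 1) * (s `^ (p - 1) * J))%R.
  rewrite mulrA -powRM ?(ltW M0)// /s mulrCA divff ?gt_eqF// mulr1 mulrC.
  by rewrite mulr_powRB1.
by move=> H; rewrite EFinM; apply: lee_wpmul2l => //; rewrite lee_fin ltW.
Qed.

Lemma tonelli_triangle (a b : R) (K D : R -> R) :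
  measurable_fun (`[a, b] : set borel) K -> measurable_fun (`[a, b] : set borel) D ->
  (forall x, x \in `[a, b] -> 0 <= K x) -> (forall x, x \in `[a, b] -> 0 <= D x) ->
  (\int[mu]_(x in `[a, b]) ((K x)%:E * \int[mu]_(y in `[x, b]) (D y)%:E) =
   \int[mu]_(y in `[a, b]) ((D y)%:E * \int[mu]_(x in `[a, y]) (K x)%:E))%E.
Proof.
move=> mK mD K0 D0.
have mab : measurable (`[a, b] : set R) by exact: measurable_itv.
pose D' := D \_ `[a, b]; pose K' := K \_ `[a, b].
have mD' : measurable_fun setT D' by apply/(measurable_restrictT _ _).1.
have mK' : measurable_fun setT K' by apply/(measurable_restrictT _ _).1.
have D'0 y : 0 <= D' y.
  by rewrite /D' patchE; case: ifPn => // /set_mem/= yab; exact: D0.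
have K'0 y : 0 <= K' y.
  by rewrite /K' patchE; case: ifPn => // /set_mem/= yab; exact: K0.
have FT := @fubini_tonelli _ _ borel borel R mu mu
  (fun z => (triangle_kernel D' K' z)%:E).
have {FT} : (\int[mu]_y \int[mu]_x (triangle_kernel D' K' (y, x))%:E =
  \int[mu]_x \int[mu]_y (triangle_kernel D' K' (y, x))%:E)%E.
  apply: FT.
    by apply/measurable_EFinP; exact: measurable_triangle_kernel.
  move=> z; rewrite lee_fin /triangle_kernel; case: ifP => // _.
  by rewrite mulr_ge0.
have sub x y : x \in `[a, b] -> y \in `[a, b] ->
  measurable (`[x, y] : set R) /\ `[x, y] `<=` `[a, b]%classic.
  move=> /itvP xab /itvP yab; split; first exact: measurable_itv.
  by apply: subset_itv; rewrite bnd_simp ?xab ?yab.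
have abb : a <= b -> b \in `[a, b] by move=> ab; rewrite in_itv/= lexx ab.
have aab : a <= b -> a \in `[a, b] by move=> ab; rewrite in_itv/= lexx ab.
move=> FT; transitivity (\int[mu]_x \int[mu]_y (triangle_kernel D' K' (y, x))%:E)%E.
  rewrite integral_mkcond; apply: eq_integral => x _.
  rewrite patchE; case: ifPn => xab; last first.
    rewrite integral0_eq// => y _;
      rewrite /triangle_kernel/= /K' patchE (negbTE xab) mulr0.
    by case: ifP.
  have xab' : x \in `[a, b] by move/set_mem : xab.
  have ab : a <= b by move: xab'; rewrite in_itv/= => /andP[]; exact: le_trans.
  have [mxb sxb] := sub _ _ xab' (abb ab).
  rewrite -ge0_integralZl; last 4 first.
  - exact: mxb.
  - by apply/measurable_EFinP; exact: measurable_funS mD.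
  - by move=> y /sxb yab; rewrite lee_fin D0.
  - by rewrite lee_fin K0.
  rewrite integral_mkcond; apply: eq_integral => y _.
  rewrite patchE /triangle_kernel/= /K' patchE xab /D' patchE mem_setE !in_itv/=
    mem_setE in_itv/=.
  have [xy|//] := leP x y.
  move: xab'; rewrite in_itv/= => /andP[ax _]; rewrite (le_trans ax xy)/=.
  by case: ifP; rewrite ?mul0r// -EFinM mulrC.
rewrite -FT; rewrite [RHS]integral_mkcond; apply: eq_integral => y _.
rewrite patchE; case: ifPn => yab; last first.
  rewrite integral0_eq// => x _;
    rewrite /triangle_kernel/= /D' patchE (negbTE yab) mul0r.
  by case: ifP.
have yab' : y \in `[a, b] by move/set_mem : yab.
have ab : a <= b by move: yab'; rewrite in_itv/= => /andP[]; exact: le_trans.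
have [may say] := sub _ _ (aab ab) yab'.
rewrite -ge0_integralZl; last 4 first.
- exact: may.
- by apply/measurable_EFinP; exact: measurable_funS mK.
- by move=> x /say xab; rewrite lee_fin K0.
- by rewrite lee_fin D0.
rewrite [RHS]integral_mkcond; apply: eq_integral => x _.
rewrite patchE /triangle_kernel/= /D' patchE yab /K' patchE mem_setE !in_itv/=
  mem_setE in_itv/=.
have [xy|] := leP x y; last by rewrite andbF.
move: yab'; rewrite in_itv/= => /andP[_ yb]; rewrite (le_trans xy yb) !andbT/=.
by case: ifP; rewrite ?mulr0// -EFinM.
Qed.

(** The tail integral is a section integral of the triangle kernel, whose
    measurability is part of Tonelli's theorem; it may be infinite. *)
Lemma measurable_tail_integral (a b : R) (D : R -> R) :
  measurable_fun (`[a, b] : set borel) D -> (forall y, y \in `[a, b] -> 0 <= D y) ->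
  measurable_fun (`[a, b] : set borel) (fun x => \int[mu]_(y in `[x, b]) (D y)%:E)%E.
Proof.
move=> mD D0; pose D' := D \_ `[a, b].
have mab : measurable (`[a, b] : set borel) by exact: measurable_itv.
have mD' : measurable_fun setT D' by apply/(measurable_restrictT _ _).1.
have D'0 y : 0 <= D' y.
  by rewrite /D' patchE; case: ifPn => // /set_mem/= yab; exact: D0.
have := @measurable_fun_fubini_tonelli_G _ _ borel borel R mu
  (fun z => (triangle_kernel D' (cst 1) z)%:E).
move=> H; have {}H : measurable_fun [set: borel]
    (fun x => \int[mu]_y (triangle_kernel D' (cst 1) (y, x))%:E)%E.
  apply: H.
    by apply/measurable_EFinP; exact: measurable_triangle_kernel.
  move=> z; rewrite lee_fin /triangle_kernel; case: ifP => // _.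
  by rewrite mulr1.
apply: (eq_measurable_fun (fun x => \int[mu]_y (triangle_kernel D' (cst 1)
  (y, x))%:E)%E);
  last exact: measurable_funTS.
move=> x; rewrite inE/= in_itv/= => /andP[ax xb].
rewrite [RHS]integral_mkcond; apply: eq_integral => y _.
rewrite patchE /triangle_kernel/= mulr1 /D' patchE !mem_setE !in_itv/=.
have [xy|//] := leP x y; rewrite (le_trans ax xy)/=.
by case: ifP.
Qed.

Lemma measurable_head_integral (a b : R) (D : R -> R) :
  measurable_fun (`[a, b] : set borel) D -> (forall y, y \in `[a, b] -> 0 <= D y) ->
  measurable_fun (`[a, b] : set borel) (fun x => \int[mu]_(y in `[a, x]) (D y)%:E)%E.
Proof.
move=> mD D0; pose D' := D \_ `[a, b].
have mab : measurable (`[a, b] : set borel) by exact: measurable_itv.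
have mD' : measurable_fun setT D' by apply/(measurable_restrictT _ _).1.
have D'0 y : 0 <= D' y.
  by rewrite /D' patchE; case: ifPn => // /set_mem/= yab; exact: D0.
have := @measurable_fun_fubini_tonelli_F _ _ borel borel R mu
  (fun z => (triangle_kernel (cst 1) D' z)%:E).
move=> H; have {}H : measurable_fun [set: borel]
    (fun x => \int[mu]_y (triangle_kernel (cst 1) D' (x, y))%:E)%E.
  apply: H.
    by apply/measurable_EFinP; exact: measurable_triangle_kernel.
  move=> z; rewrite lee_fin /triangle_kernel; case: ifP => // _.
  by rewrite mul1r.
apply: (eq_measurable_fun (fun x => \int[mu]_y (triangle_kernel (cst 1) D'
  (x, y))%:E)%E);
  last exact: measurable_funTS.
move=> x; rewrite inE/= in_itv/= => /andP[ax xb].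
rewrite [RHS]integral_mkcond; apply: eq_integral => y _.
rewrite patchE /triangle_kernel/= mul1r /D' patchE !mem_setE !in_itv/=.
have [yx|yx] := leP y x; last by rewrite andbF.
by rewrite (le_trans yx xb) !andbT; case: ifP.
Qed.

End Hardy.

(** * The Hardy inequality with weights that are powers of h *)

Section WeightedHardy.
Context {R : realType}.
Notation mu := (@lebesgue_measure R).
Local Notation borel := (measurableTypeR R).
Context (h dh : R -> R) (d c0 : R).
Context (c0_gt0 : 0 < c0) (hpos : forall x : R, 0 < x -> 0 < h x)
  (hD : forall x : R, 0 < x -> is_derive x (1 : R) h (dh x))
  (cdh : forall x : R, 0 < x -> {for x, continuous dh})
  (hc : forall x : R, 0 < x <= d -> c0 <= dh x).

Lemma continuous_weight (s x y : R) : 0 < x -> {within `[x, y], continuous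
  (fun t => h t `^ s)}.
Proof.
move=> x0; apply: continuous_in_subspaceT => t /set_mem /(itv_sub_Rpos x0).
rewrite RposE => t0; apply: continuous_powR_comp; first exact: hpos.
apply/differentiable_continuous/derivable1_diffP.
by have ? := hD t0; exact: ex_derive.
Qed.

Lemma measurable_weight (s x y : R) : 0 < x ->
  measurable_fun (`[x, y] : set borel) (fun t => h t `^ s).
Proof.
by move=> x0; apply: subspace_continuous_measurable_fun => //; exact: continuous_weight.
Qed.

(** The only way in which the lower bound of h' is used: h^(s - 1) is at most
    the derivative of h^s / (s c0), for either sign of s. *)
Lemma weight_integral (s x y : R) : s != 0 -> 0 < x -> x <= y -> y <= d ->
  (\int[mu]_(t in `[x, y]) (h t `^ (s - 1))%:E <=
    ((h y `^ s - h x `^ s) / (s * c0))%:E)%E.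
Proof.
move=> s0 x0 xy yd.
have pos t : x <= t -> 0 < t by exact: lt_le_trans.
pose f t := (s * c0)^-1 * (s * h t `^ (s - 1) * dh t).
have cf : {within `[x, y], continuous f}.
  apply: continuous_in_subspaceT => t /set_mem /(itv_sub_Rpos x0).
  rewrite RposE => t0; apply: cvgMl_tmp; apply: cvgM; last exact: cdh.
  apply: cvgMl_tmp; apply: continuous_powR_comp; first exact: hpos.
  apply/differentiable_continuous/derivable1_diffP.
  by have ? := hD t0; exact: ex_derive.
have dF t : x <= t <= y -> is_derive t (1 : R) (fun t => (s * c0)^-1 * h t `^ s) (f t).
  move=> /andP[/pos t0 _].
  have ? := is_derive_powR_comp s (hpos t0) (hD t0).
  exact: is_deriveZ.
have -> : ((h y `^ s - h x `^ s) / (s * c0) =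
    (s * c0)^-1 * h y `^ s - (s * c0)^-1 * h x `^ s)%R by ring.
rewrite -(integral_is_derive xy dF cf).
apply: ge0_le_integral => //.
- by move=> t _; rewrite lee_fin powR_ge0.
- by apply/measurable_EFinP; exact: measurable_weight.
- by apply/measurable_EFinP; exact: subspace_continuous_measurable_fun.
move=> t; rewrite /= in_itv/= => /andP[xt ty]; rewrite lee_fin /f.
have -> : (s * c0)^-1 * (s * h t `^ (s - 1) * dh t) = h t `^ (s - 1) * (dh t / c0).
  by field; rewrite s0 gt_eqF.
rewrite ler_peMr ?powR_ge0// ler_pdivlMr// mul1r hc// pos//=.
exact: le_trans yd.
Qed.

(** The power mean inequality for the density h^(- kappa - 1) and the function
    h^(1 / p) G. This choice of the exponents makes the p-th power of
    h^(kappa - 1 / p) J a multiple of h^(kappa - 1) times a tail integral, and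
    h^(kappa - 1) is integrable near 0. *)
Lemma hardy_pointwise (G : R -> R) (p kappa J x : R) : 1 <= p -> 0 < kappa ->
  0 < x -> x <= d ->
  measurable_fun (`[x, d] : set borel) G -> (forall y, 0 <= G y) ->
  0 <= J ->
  (J%:E <= \int[mu]_(y in `[x, d]) (h y `^ (- (kappa - p^-1) - 1) * G y)%:E)%E ->
  (((h x `^ (kappa - p^-1) * J) `^ p)%:E <=
    ((kappa * c0)^-1 `^ (p - 1) * h x `^ (kappa - 1))%:E *
    \int[mu]_(y in `[x, d]) (G y `^ p * h y `^ (- kappa))%:E)%E.
Proof.
move=> p1 k0 x0 xd mG G0 J0 JG.
have p0 : 0 < p by exact: lt_le_trans p1.
have pos t : t \in `[x, d] -> 0 < t.
  by rewrite in_itv/= => /andP[+ _]; exact: lt_le_trans.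
pose m y := h y `^ (- kappa - 1).
pose F y := h y `^ p^-1 * G y.
have hx0 := hpos x0.
have kc0 : 0 < kappa * c0 by rewrite mulr_gt0.
pose M := h x `^ (- kappa) / (kappa * c0).
have M0 : 0 < M by rewrite divr_gt0// powR_gt0.
have mM : (\int[mu]_(y in `[x, d]) (m y)%:E <= M%:E)%E.
  apply: le_trans; first by apply: weight_integral => //; rewrite oppr_eq0 gt_eqF.
  rewrite lee_fin /M mulNr invrN mulrN -mulNr opprB ler_wpM2r ?invr_ge0 ?(ltW kc0)//.
  by rewrite lerBlDr lerDl powR_ge0.
have mm : measurable_fun (`[x, d] : set borel) m by exact: measurable_weight.
have mF : measurable_fun (`[x, d] : set borel) F.
  by apply: measurable_funM => //; exact: measurable_weight.
have JF : (J%:E <= \int[mu]_(y in `[x, d]) (F y * m y)%:E)%E.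
  rewrite (le_trans JG)// le_eqVlt; apply/orP; left; apply/eqP.
  apply: eq_integral => y /set_mem/= /pos y0; congr (_%:E).
  rewrite /F /m mulrAC -gt0_powRD ?hpos//; congr (_ `^ _ * _); ring.
have := @power_mean _ (`[x, d] : set borel) m F p M J (measurable_itv _) mm mF
   (fun y _ => powR_ge0 _ _) (fun y _ => mulr_ge0 (powR_ge0 _ _) (G0 y)) p1 M0 mM J0 JF.
have -> : (\int[mu]_(y in `[x, d]) (F y `^ p * m y)%:E =
    \int[mu]_(y in `[x, d]) (G y `^ p * h y `^ (- kappa))%:E)%E.
  apply: eq_integral => y /set_mem/= /pos y0; congr (_%:E).
  rewrite /F /m powRM ?powR_ge0// -powRrM mulVf ?gt_eqF// powRr1 ?(ltW (hpos y0))//.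
  rewrite mulrAC -{1}(powRr1 (ltW (hpos y0))) -gt0_powRD ?hpos// mulrC.
  by congr (_ * _ `^ _); ring.
have -> : ((kappa * c0)^-1 `^ (p - 1) * h x `^ (kappa - 1) =
    (h x `^ (kappa - p^-1)) `^ p * M `^ (p - 1))%R.
  rewrite /M powRM ?powR_ge0 ?invr_ge0 ?(ltW kc0)// mulrCA mulrA -!powRrM mulrAC.
  rewrite [RHS]mulrAC -gt0_powRD// [RHS]mulrC; congr (_ * _ `^ _).
  by field; rewrite gt_eqF.
move=> H; rewrite powRM ?powR_ge0// EFinM [in leRHS]EFinM -muleA.
by apply: lee_wpmul2l => //; rewrite lee_fin powR_ge0.
Qed.

(** After the exchange of the integrals, the inner one is
    \int_e^y h^(kappa - 1) <= h(y)^kappa / (kappa c0), which compensates the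
    weight h(y)^(- kappa). *)
Lemma hardy_tonelli (e kappa : R) (H : R -> R) : 0 < kappa -> 0 < e ->
  measurable_fun (`[e, d] : set borel) H -> (forall y, 0 <= H y) ->
  (\int[mu]_(x in `[e, d]) ((h x `^ (kappa - 1))%:E *
      \int[mu]_(y in `[x, d]) (H y * h y `^ (- kappa))%:E) <=
   (kappa * c0)^-1%:E * \int[mu]_(y in `[e, d]) (H y)%:E)%E.
Proof.
move=> k0 e0 mH H0.
have kc0 : 0 < kappa * c0 by rewrite mulr_gt0.
have pos t : t \in `[e, d] -> 0 < t.
  by rewrite in_itv/= => /andP[+ _]; exact: lt_le_trans.
have mw := @measurable_weight (kappa - 1) e d e0.
have mw' := @measurable_weight (- kappa) e d e0.
have mHw : measurable_fun (`[e, d] : set borel) (fun y => H y * h y `^ (- kappa)).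
  exact: measurable_funM.
rewrite (@tonelli_triangle _ e d (fun x => h x `^ (kappa - 1))
  (fun y => H y * h y `^ (- kappa)))//; last 2 first.
- by move=> x _; exact: powR_ge0.
- by move=> y _; rewrite mulr_ge0// powR_ge0.
rewrite -ge0_integralZl//; last 3 first.
- exact/measurable_EFinP.
- by move=> y _; rewrite lee_fin.
- by rewrite lee_fin invr_ge0 ltW.
apply: ge0_le_integral => //.
- by move=> y _; rewrite mule_ge0 ?lee_fin ?mulr_ge0 ?powR_ge0// integral_ge0// =>
    x _; rewrite lee_fin powR_ge0.
- apply: emeasurable_funM; first exact/measurable_EFinP.
  by apply: measurable_head_integral => // x _; exact: powR_ge0.
- by apply: measurable_funeM; exact/measurable_EFinP.
move=> y /= yed; have y0 := pos _ yed; have hy0 := hpos y0.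
move: yed; rewrite in_itv/= => /andP[ey yd].
apply: (@le_trans _ _ ((H y * h y `^ (- kappa))%:E * (h y `^ kappa /
  (kappa * c0))%:E)%E).
  apply: lee_wpmul2l; first by rewrite lee_fin mulr_ge0// powR_ge0.
  apply: le_trans; first by apply: weight_integral => //; rewrite gt_eqF.
  by rewrite lee_fin ler_wpM2r ?invr_ge0 ?(ltW kc0)// gerBl powR_ge0.
rewrite -!EFinM lee_fin mulrA -[_ * h y `^ kappa]mulrA -gt0_powRD//.
by rewrite addNr powRr0 mulr1 mulrC.
Qed.

(** From here on, w is any function whose modulus grows at most like the integral
    of h^(- beta - 1) G towards 0, outside a null set. *)
Context (m : R) (md : m <= d) (E : set R) (w G : R -> R)
  (EE : {ae mu, forall x, E x}) (G0 : forall y, 0 <= G y)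
  (iG : forall a : R, 0 < a -> mu.-integrable `[a, d] (EFin \o G))
  (beta : R)
  (wG : forall x y : R, 0 < x -> x < y -> E x -> E y ->
     `|w x| <= `|w y| + \int[mu]_(t in `[x, y]) (h t `^ (- beta - 1) * G t)).

Let J x := \int[mu]_(t in `[x, d]) (h t `^ (- beta - 1) * G t).

Let iwG x y : 0 < x -> y <= d ->
  mu.-integrable `[x, y] (EFin \o (fun t => h t `^ (- beta - 1) * G t)).
Proof.
move=> x0 yd; apply: integrable_continuousM; first exact: continuous_weight.
by apply: integrableS (iG x0) => //; apply: subset_itvl; rewrite bnd_simp.
Qed.

Let J_ge0 x : 0 <= J x.
Proof. by apply: Rintegral_ge0 => t _; rewrite mulr_ge0// powR_ge0. Qed.

Let EFin_J x : 0 < x -> ((J x)%:E =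
  \int[mu]_(t in `[x, d]) (h t `^ (- beta - 1) * G t)%:E)%E.
Proof.
by move=> x0; rewrite /J /Rintegral fineK//; apply: integrable_fin_num => //;
  exact: iwG.
Qed.

Let wJ x y : 0 < x -> x <= m -> m <= y -> y <= d -> E x -> E y ->
  `|w x| <= `|w y| + J x.
Proof.
move=> x0 xm my yd Ex Ey; have := le_trans xm my.
rewrite le_eqVlt => /predU1P[->|xy]; first by rewrite lerDl.
apply: (le_trans (wG x0 xy Ex Ey)); rewrite lerD2l -lee_fin (EFin_J x0).
rewrite /Rintegral fineK; last by apply: integrable_fin_num => //; exact: iwG.
apply: ge0_subset_integral => //.
- by apply: (measurable_int mu); exact: iwG.
- by move=> t _; rewrite lee_fin mulr_ge0// powR_ge0.
- by apply: subset_itvl; rewrite bnd_simp.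
Qed.

(** The constants do not depend on e, which lets e tend to 0 afterwards. *)
Lemma near_zero_Lp (p kappa e y : R) : 1 <= p -> 0 < kappa ->
  beta = kappa - p^-1 -> 0 < e -> e <= m -> measurable_fun (`[e, m] : set borel) w ->
  m <= y -> y <= d -> E y ->
  (\int[mu]_(x in `[e, m]) ((h x `^ beta * `|w x|) `^ p)%:E <=
    (2 `^ p * (h m `^ (kappa * p) / (kappa * p * c0)))%:E * (`|w y| `^ p)%:E +
    (2 `^ p * ((kappa * c0)^-1 `^ (p - 1) * (kappa * c0)^-1))%:E *
      \int[mu]_(x in `[e, d]) (G x `^ p)%:E)%E.
Proof.
move=> p1 k0 bE e0 em mw my yd Ey.
have p0 : 0 < p by exact: lt_le_trans p1.
have kc0 : 0 < kappa * c0 by rewrite mulr_gt0.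
have pos (t : R) : t \in `[e, m] -> 0 < t.
  by rewrite in_itv/= => /andP[+ _]; exact: lt_le_trans.
have med : `[e, m]%classic `<=` `[e, d] by apply: subset_itvl; rewrite bnd_simp.
have mG : measurable_fun (`[e, d] : set borel) G.
  by have /measurable_int/measurable_EFinP := iG e0.
have mGp : measurable_fun (`[e, d] : set borel) (fun t => G t `^ p).
  exact: (measurableT_comp (measurable_powR p)).
have mGk : measurable_fun (`[e, d] : set borel) (fun t => G t `^ p * h t `^ (- kappa)).
  by apply: measurable_funM => //; exact: measurable_weight.
pose T x := (\int[mu]_(t in `[x, d]) (G t `^ p * h t `^ (- kappa))%:E)%E.
have mT : measurable_fun (`[e, d] : set borel) T.
  by apply: measurable_tail_integral => // t _; rewrite mulr_ge0 ?powR_ge0.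
have T0 x : (0 <= T x)%E.
  by apply: integral_ge0 => t _; rewrite lee_fin mulr_ge0 ?powR_ge0.
pose C := (kappa * c0)^-1 `^ (p - 1).
have C0 : 0 <= C by exact: powR_ge0.
have two0 : 0 <= 2 `^ p :> R by exact: powR_ge0.
have mPhi : measurable_fun (`[e, d] : set borel)
    (fun x => ((h x `^ (kappa - 1))%:E * T x)%E).
  by apply: emeasurable_funM => //; apply/measurable_EFinP; exact: measurable_weight.
have mhp : measurable_fun (`[e, m] : set borel) (fun x => (h x `^ (kappa * p - 1))%:E).
  by apply/measurable_EFinP; exact: measurable_weight.
have Phi0 x : (0 <= (h x `^ (kappa - 1))%:E * T x)%E.
  by rewrite mule_ge0// lee_fin powR_ge0.
apply: (@le_trans _ _ (\int[mu]_(x in `[e, m])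
   ((2 `^ p * `|w y| `^ p)%:E * (h x `^ (kappa * p - 1))%:E +
    (2 `^ p * C)%:E * ((h x `^ (kappa - 1))%:E * T x)))%E).
  apply: ae_ge0_le_integral => //.
  - by move=> x _; rewrite lee_fin powR_ge0.
  - apply/measurable_EFinP; apply: (measurableT_comp (measurable_powR p)).
    apply: measurable_funM; first exact: measurable_weight.
    exact: measurableT_comp.
  - move=> x _; apply: adde_ge0; first by rewrite -EFinM lee_fin !mulr_ge0 ?powR_ge0.
    by rewrite mule_ge0// lee_fin mulr_ge0.
  - apply: emeasurable_funD; first exact: measurable_funeM.
    by apply: measurable_funeM; exact: measurable_funS mPhi.
  move: EE; apply: filterS; first exact: (ae_filter_ringOfSetsType mu).
  move=> x Ex /= xem; have x0 := pos _ xem.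
  move: xem; rewrite in_itv/= => /andP[ex xm].
  have xd := le_trans xm md.
  have P := @hardy_pointwise G p kappa (J x) x p1 k0 x0 xd.
  have mGx : measurable_fun (`[x, d] : set borel) G.
    by apply: measurable_funS mG => //; apply: subset_itvr; rewrite bnd_simp.
  have {}P := P mGx G0 (J_ge0 x).
  rewrite -bE in P.
  have {}P : (((h x `^ beta * J x) `^ p)%:E <= (C * h x `^ (kappa - 1))%:E * T x)%E.
    by apply: P; rewrite EFin_J.
  apply: (@le_trans _ _ (2 `^ p * ((h x `^ beta * `|w y|) `^ p +
    (h x `^ beta * J x) `^ p))%:E).
    rewrite lee_fin; apply: le_trans (powRD_le _ _ _);
      rewrite ?mulr_ge0 ?powR_ge0 ?(ltW p0)//.
    apply: ge0_ler_powR; rewrite ?nnegrE ?addr_ge0 ?mulr_ge0 ?powR_ge0 ?(ltW p0)//.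
    by rewrite -mulrDr ler_wpM2l ?powR_ge0// wJ.
  rewrite mulrDr EFinD; apply: leeD.
    rewrite -EFinM lee_fin powRM ?powR_ge0// -powRrM.
    have -> : (beta * p = kappa * p - 1)%R by rewrite bE; field; rewrite gt_eqF.
    by rewrite -mulrA ler_wpM2l// mulrC.
  rewrite EFinM [in leRHS]EFinM -[leRHS]muleA; apply: lee_wpmul2l => //.
  by rewrite muleA -EFinM.
rewrite ge0_integralD//; last 4 first.
- by move=> x _; rewrite -EFinM lee_fin !mulr_ge0 ?powR_ge0.
- exact: measurable_funeM.
- by move=> x _; rewrite mule_ge0// lee_fin mulr_ge0.
- by apply: measurable_funeM; exact: measurable_funS mPhi.
rewrite ge0_integralZl//; last first.
  by move=> x _; rewrite lee_fin powR_ge0.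
rewrite ge0_integralZl//; last 2 first.
- exact: measurable_funS mPhi.
- by rewrite lee_fin mulr_ge0.
apply: leeD.
  have -> q z v : ((q * z)%:E * v%:E = (q * v)%:E * z%:E :> \bar R)%E.
    by rewrite -!EFinM mulrAC.
  apply: lee_wpmul2l.
    by rewrite lee_fin mulr_ge0// powR_ge0.
  apply: le_trans; first by apply: weight_integral => //; rewrite mulf_neq0// gt_eqF.
  rewrite lee_fin ler_wpM2r ?invr_ge0 ?mulr_ge0 ?(ltW k0) ?(ltW p0) ?(ltW c0_gt0)//.
  by rewrite gerBl powR_ge0.
rewrite mulrA [in leRHS]EFinM -[leRHS]muleA; apply: lee_wpmul2l.
  by rewrite lee_fin mulr_ge0.
have := @hardy_tonelli e kappa (fun t => G t `^ p) k0 e0 mGp (fun t => powR_ge0 _ _).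
apply: le_trans.
by apply: ge0_subset_integral => // x _; exact: Phi0.
Qed.

(** For p = oo one has kappa = beta > 0, and the tail integral of
    h^(- beta - 1) is at most h(x)^(- beta) / (beta c0). *)
Lemma near_zero_Linfty (N x y : R) : 0 < beta -> 0 <= N ->
  {ae mu, forall t, 0 < t -> G t <= N} ->
  0 < x -> x <= m -> m <= y -> y <= d -> E x -> E y ->
  h x `^ beta * `|w x| <= h m `^ beta * `|w y| + N / (beta * c0).
Proof.
move=> b0 N0 GN x0 xm my yd Ex Ey.
have xd := le_trans xm md.
have bc0 : 0 < beta * c0 by rewrite mulr_gt0.
have hx0 := hpos x0.
have mw1 := @measurable_weight (- beta - 1) x d x0.
have JN : (J x <= N * (h x `^ (- beta) / (beta * c0)))%R.
  rewrite -lee_fin EFin_J//.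
  apply: (@le_trans _ _ (\int[mu]_(t in `[x, d]) (N%:E * (h t `^ (- beta - 1))%:E))%E).
    apply: ae_ge0_le_integral => //.
    - by move=> t _; rewrite lee_fin mulr_ge0// powR_ge0.
    - by apply: (measurable_int mu); exact: iwG.
    - by move=> t _; rewrite -EFinM lee_fin mulr_ge0// powR_ge0.
    - by apply: measurable_funeM; exact/measurable_EFinP.
    move: GN; apply: filterS; first exact: (ae_filter_ringOfSetsType mu).
    move=> t Gt /=; rewrite in_itv/= => /andP[xt _].
    by rewrite -EFinM lee_fin mulrC ler_wpM2r ?powR_ge0// Gt// (lt_le_trans x0).
  rewrite ge0_integralZl//; last 2 first.
  - exact/measurable_EFinP.
  - by move=> t _; rewrite lee_fin powR_ge0.
  rewrite EFinM; apply: lee_wpmul2l => //.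
  apply: le_trans; first by apply: weight_integral => //; rewrite oppr_eq0 gt_eqF.
  rewrite lee_fin mulNr invrN mulrN -mulNr opprB ler_wpM2r ?invr_ge0 ?(ltW bc0)//.
  by rewrite lerBlDr lerDl powR_ge0.
have hm : h x `^ beta <= h m `^ beta.
  have := @weight_integral beta x m; rewrite gt_eqF// => /(_ isT x0 xm md).
  move=> /(le_trans _) H; have : (0 <= ((h m `^ beta - h x `^ beta) /
    (beta * c0))%:E)%E.
    by apply: H; apply: integral_ge0 => t _; rewrite lee_fin powR_ge0.
  by rewrite lee_fin pmulr_lge0 ?invr_gt0// subr_ge0.
apply: (@le_trans _ _ (h x `^ beta * (`|w y| + J x))).
  by rewrite ler_wpM2l ?powR_ge0// wJ.
rewrite mulrDr; apply: lerD; first by rewrite ler_wpM2r.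
apply: (@le_trans _ _ (h x `^ beta * (N * (h x `^ (- beta) / (beta * c0))))).
  by rewrite ler_wpM2l ?powR_ge0.
rewrite mulrCA mulrA -mulrA [h x `^ beta * _]mulrA -gt0_powRD// subrr powRr0.
by rewrite mulrA mulr1.
Qed.

End WeightedHardy.

(** * Lower bounds of h, and norms on the half-line *)

Section LowerBounds.
Context {R : realType}.
Implicit Types (h : R -> R).

Lemma half_derive_lower_bound h : C1_half h -> 0 < half_derive h 0 ->
  exists d c : R, [/\ 0 < d, 0 < c & forall x : R, 0 < x <= d -> c <= half_derive h x].
Proof.
move=> [_ /continuous_within_itvcyP[_ cd]] d0.
have : \forall x \near (0 : R)^'+, half_derive h 0 / 2 < half_derive h x.
  by apply: (cvgr_gt _ cd); rewrite ltr_pdivrMr// mulr_natr mulr2n ltrDl.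
move=> [e /= e0 He]; exists (e / 2), (half_derive h 0 / 2); split.
- by rewrite divr_gt0.
- by rewrite divr_gt0.
move=> x /andP[x0 xe]; apply/ltW/He => //=.
rewrite sub0r normrN gtr0_norm//; apply: (le_lt_trans xe).
by rewrite ltr_pdivrMr// mulr_natr mulr2n ltrDl.
Qed.

(** The lower limit gives a bound near infinity, and continuity together with
    positivity a bound on the remaining compact interval. *)
Lemma lower_bound_half_line h (m : R) : 0 < m ->
  (forall x : R, 0 < x -> {for x, continuous h}) ->
  (forall x : R, 0 < x -> 0 < h x) ->
  (0 < limf_einf (EFin \o h) (pinfty_nbhs R))%E ->
  exists2 c : R, 0 < c & forall x, m <= x -> c <= h x.
Proof.
move=> m0 ch hpos; rewrite limf_einfE => /ereal_sup_gt[_ [V [M [_ MV]] <-]] infV.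
have [c c0 cV] : exists2 c : R, 0 < c & forall x, V x -> c <= h x.
  have lb x : V x -> (ereal_inf [set (EFin \o h) x | x in V] <= (h x)%:E)%E.
    by move=> Vx; apply: ereal_inf_lbound; exists x.
  case: (ereal_inf _) infV lb => [r|_|//]; rewrite ?lte_fin.
    by move=> r0 lb; exists r => // x Vx; rewrite -lee_fin; exact: lb.
  by move=> lb; exists 1 => // x /lb; rewrite leye_eq.
pose N := Num.max m (M + 1).
have mN : m <= N by rewrite le_max lexx.
have [x0 x0m Hx0] : exists2 x0, x0 \in `[m, N] & forall t, t \in `[m, N] -> h x0 <= h t.
  apply: EVT_min => //; apply: continuous_in_subspaceT => x /set_mem/(itv_sub_Rpos m0).
  by rewrite RposE; exact: ch.
have hx0 : 0 < h x0.
  by apply: hpos; move: x0m; rewrite in_itv/= => /andP[+ _]; exact: lt_le_trans.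
exists (Num.min c (h x0)); first by rewrite lt_min c0.
move=> x mx; have [xN|Nx] := leP x N.
  by rewrite ge_min Hx0 ?orbT// in_itv/= mx.
rewrite ge_min cV//; apply: MV; apply: lt_trans Nx.
by rewrite lt_max ltrDl ltr01 orbT.
Qed.

End LowerBounds.

Section LpHalfLine.
Context {R : realType}.
Notation mu := (@lebesgue_measure R).
Local Notation borel := (measurableTypeR R).
Implicit Types (f g : R -> R).

Lemma Lp_posP (p : \bar R) f : Lp_pos p f <->
  measurable_fun (Rpos : set borel) f /\ (Lp_norm_pos p f < +oo)%E.
Proof.
have mR : measurable (Rpos : set borel) by exact: measurable_Rpos.
split.
  move=> /andP[]; rewrite !inE/= => mf lf; split=> //.
  by apply/(measurable_restrictT _ _).2.
move=> [mf lf]; apply/andP; rewrite !inE/=; split=> //.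
by apply/(measurable_restrictT _ _).1.
Qed.

Lemma Lp_norm_pos_powR (r : R) f : r != 0 ->
  ((Lp_norm_pos r%:E f) `^ r = \int[mu]_(x in Rpos) (`|f x| `^ r)%:E)%E.
Proof.
move=> r0; rewrite /Lp_norm_pos (poweR_Lnorm _ _ r0) [RHS]integral_mkcond.
apply: eq_integral => x _; rewrite patchE /= patchE.
case: ifPn => _ //=; by rewrite normr0 powR0.
Qed.

Lemma Linfty_ae_le f (c : R) : (Lp_norm_pos +oo%E f <= c%:E)%E ->
  {ae mu, forall x, 0 < x -> `|f x| <= c}.
Proof.
rewrite /Lp_norm_pos unlock ifT; last first.
  apply: (@lt_le_trans _ _ (mu `[0%R, 1%R]%classic)).
    by rewrite lebesgue_measure_itv/= lte_fin ltr01 -EFinB subr0 lte_fin.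
  by apply: le_measure; rewrite ?inE.
move=> /ess_supP H; apply: filterS H => x /= + x0.
by rewrite patchE mem_set ?RposE// lee_fin.
Qed.

Lemma Linfty_norm_le f (c : R) : 0 <= c ->
  {ae mu, forall x, 0 < x -> `|f x| <= c} -> (Lp_norm_pos +oo%E f <= c%:E)%E.
Proof.
move=> c0 fc; rewrite /Lp_norm_pos unlock; case: ifP => // _.
apply/ess_supP; move: fc.
apply: filterS; first exact: (ae_filter_ringOfSetsType mu).
move=> x fx /=; rewrite patchE; case: ifPn => [/set_mem|_]; last by rewrite normr0.
by rewrite RposE => /fx; rewrite lee_fin.
Qed.

Lemma Lp_pos_integrable_itv (p : \bar R) g (a b : R) : (1 <= p)%E ->
  Lp_pos p g -> 0 < a -> mu.-integrable `[a, b] (EFin \o g).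
Proof.
move=> p1 /Lp_posP[mg lg] a0.
have sub := @itv_sub_Rpos R a b a0.
have mab : measurable (`[a, b] : set borel) by exact: measurable_itv.
have mR : measurable (Rpos : set borel) by exact: measurable_Rpos.
have mgab : measurable_fun (`[a, b] : set borel) g.
  exact: measurable_funS mg.
apply/integrableP; split; first exact/measurable_EFinP.
have finab : (mu `[a, b]%classic < +oo)%E.
  by rewrite lebesgue_measure_itv/=; case: ifP => // _; rewrite -EFinB ltry.
case: p p1 lg => [r| |//] p1 lg.
- rewrite lee_fin in p1; have r0 : 0 < r by exact: lt_le_trans p1.
  have mgr : measurable_fun (Rpos : set borel) (fun x => (`|g x| `^ r)%:E).
    apply/measurable_EFinP; apply: (measurableT_comp (measurable_powR r)).
    exact: measurableT_comp.
  apply: (@le_lt_trans _ _ (\int[mu]_(x in `[a, b]) (1%:E + (`|g x| `^ r)%:E))%E).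
    apply: ge0_le_integral => //.
    + by apply: measurableT_comp => //; exact/measurable_EFinP.
    + by apply: emeasurable_funD => //; exact: measurable_funS mgr.
    move=> x _; rewrite -EFinD lee_fin.
    have [g1|/ltW g1] := leP `|g x| 1; first by rewrite (le_trans g1)// lerDl powR_ge0.
    by apply: (le_trans (le1r_powR g1 p1)); rewrite lerDr.
  rewrite ge0_integralD//; last exact: measurable_funS mgr.
  rewrite integral_cst// mul1e; apply: lte_add_pinfty => //.
  apply: (@le_lt_trans _ _ (\int[mu]_(x in Rpos) (`|g x| `^ r)%:E)%E).
    exact: ge0_subset_integral.
  by rewrite -Lp_norm_pos_powR ?gt_eqF// poweR_lty.
- have [c c0 lc] : exists2 c : R, 0 <= c & (Lp_norm_pos +oo%E g <= c%:E)%E.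
    exists (fine (Lp_norm_pos +oo%E g)); first by rewrite fine_ge0// Lnorm_ge0.
    by rewrite fineK// ge0_fin_numE// Lnorm_ge0.
  apply: (@le_lt_trans _ _ (\int[mu]_(x in `[a, b]) c%:E)%E); last first.
    by rewrite integral_cst// lte_mul_pinfty.
  apply: ae_ge0_le_integral => //.
  + by apply: measurableT_comp => //; exact/measurable_EFinP.
  move: (Linfty_ae_le lc); apply: filterS; first exact: (ae_filter_ringOfSetsType mu).
  move=> x gx /sub; rewrite RposE => /gx.
  by rewrite lee_fin.
Qed.

End LpHalfLine.

(** * The weighted estimate *)

Section WeightedEstimate.
Context {R : realType}.
Notation mu := (@lebesgue_measure R).
Local Notation borel := (measurableTypeR R).
Context (alpha sigma : R) (h : R -> R).
Context (C1h : C1_half h) (dh0 : 0 < half_derive h 0)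
  (hpos : forall x : R, 0 < x -> 0 < h x)
  (hinf : (0 < limf_einf (EFin \o h) (pinfty_nbhs R))%E).

Let beta := sigma - alpha.

Let dh (x : R) : 0 < x -> is_derive x (1 : R) h (half_derive h x).
Proof. exact: is_derive_half. Qed.

Let cdh (x : R) : 0 < x -> {for x, continuous (half_derive h)}.
Proof. exact: continuous_half_derive. Qed.

Let ch (x : R) : 0 < x -> {for x, continuous h}.
Proof.
move=> x0; apply/differentiable_continuous/derivable1_diffP.
by have ? := dh x0; exact: ex_derive.
Qed.

Let mweight s : measurable_fun (Rpos : set borel) (fun x => h x `^ s).
Proof.
apply: open_continuous_measurable_fun; first exact: open_Rpos.
move=> x /set_mem; rewrite RposE => x0.
by apply: continuous_powR_comp; [exact: hpos|exact: ch].
Qed.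

Let constants : exists d c0 c1 : R, [/\ 0 < d, 0 < c0, 0 < c1,
  forall x : R, 0 < x <= d -> c0 <= half_derive h x &
  forall x : R, d / 2 <= x -> c1 <= h x].
Proof.
have [d [c0 [d0 c00 Hd]]] := half_derive_lower_bound C1h dh0.
have m0 : 0 < d / 2 by rewrite divr_gt0.
have [c1 c10 Hc] := lower_bound_half_line m0 ch hpos hinf.
by exists d, c0, c1; split.
Qed.

Let weight_bounded s (a b : R) : 0 < a -> a <= b ->
  exists2 B : R, 0 <= B & forall x, a <= x <= b -> h x `^ s <= B.
Proof.
move=> a0 ab.
have [c cab Hc] : exists2 c, c \in `[a, b] &
    forall t, t \in `[a, b] -> h t `^ s <= h c `^ s.
  apply: (@EVT_max R (fun x => h x `^ s)) => //.
  by apply: (@continuous_weight R h (half_derive h)).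
by exists (h c `^ s); [exact: powR_ge0|move=> x xab; apply: Hc; rewrite in_itv].
Qed.

Let vE u x : 0 < x -> h x `^ sigma * u x = h x `^ beta * (h x `^ alpha * u x).
Proof. by move=> x0; rewrite mulrA -gt0_powRD ?hpos// subrK. Qed.

Let wE u x : 0 < x ->
  h x `^ alpha * u x = h x `^ (- beta - 1) * (h x `^ (sigma + 1) * u x).
Proof.
move=> x0; rewrite mulrA -gt0_powRD ?hpos//; congr (_ `^ _ * _).
by rewrite /beta; ring.
Qed.

Let weight_shift u (c x : R) : 0 < x -> c <= h x ->
  c * `|h x `^ sigma * u x| <= `|h x `^ (sigma + 1) * u x|.
Proof.
move=> x0 cx; rewrite gt0_powRD ?hpos// powRr1 ?(ltW (hpos x0))// mulrAC.
by rewrite [leRHS]normrM [leRHS]mulrC ler_wpM2r// (le_trans cx)// ler_norm.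
Qed.

Let increment_bound u g : locally_integrable Rpos u ->
  (forall a b, 0 < a -> mu.-integrable `[a, b] (EFin \o g)) ->
  distr_represents
    (distr_mul (fun x => h x `^ sigma) (Dalpha alpha h u)) g ->
  exists2 E : set R, {ae mu, forall x, E x} &
    forall x y : R, 0 < x -> x < y -> E x -> E y ->
    `|h x `^ alpha * u x| <= `|h y `^ alpha * u y| +
      \int[mu]_(t in `[x, y]) (h t `^ (- beta - 1) * `|g t|).
Proof.
move=> lu ig rep; have [E EE HE] := ae_representation C1h hpos lu ig rep.
exists E => // x y x0 xy Ex Ey.
have -> : h x `^ alpha * u x = h y `^ alpha * u y -
    \int[mu]_(t in `[x, y]) (h t `^ (alpha - sigma - 1) * g t).
  by rewrite -(HE x y)//; ring.
rewrite (le_trans (ler_normB _ _))// lerD2l.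
have iwg : mu.-integrable `[x, y]
    (EFin \o (fun t => h t `^ (alpha - sigma - 1) * g t)).
  apply: integrable_continuousM; last exact: ig.
  exact: (@continuous_weight R h (half_derive h)).
apply: (le_trans (le_normr_Rintegral _ iwg)) => //.
rewrite le_eqVlt; apply/orP; left; apply/eqP; apply: eq_Rintegral => t _.
rewrite normrM ger0_norm ?powR_ge0//; congr (_ `^ _ * _).
by rewrite /beta; ring.
Qed.

Let measurable_weightM u : locally_integrable Rpos u -> forall s,
  measurable_fun (Rpos : set borel) (fun x => h x `^ s * u x).
Proof. by move=> [mu_ _ _] s; apply: measurable_funM. Qed.

Let measurable_normpow (f : R -> R) (r : R) : measurable_fun (Rpos : set borel) f ->
  measurable_fun (Rpos : set borel) (fun x => (`|f x| `^ r)%:E).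
Proof.
move=> mf; apply/measurable_EFinP; apply: (measurableT_comp (measurable_powR r)).
exact: measurableT_comp.
Qed.

(** The estimate in terms of p-th powers of the norms. The bound near 0 holds for
    almost every y in [m, d] with the same left-hand side; integrating it over
    y replaces the value of h^(sigma + 1) u at y by its norm. *)
Lemma power_integral_estimate (r : R) : 1 <= r -> alpha - r^-1 < sigma ->
  exists2 C : R, 0 <= C & forall u g : R -> R,
    locally_integrable Rpos u ->
    distr_represents
      (distr_mul (fun x => h x `^ sigma) (Dalpha alpha h u)) g ->
    Lp_pos r%:E g ->
    forall nf ng : R,
    (\int[mu]_(x in Rpos) (`|h x `^ (sigma + 1) * u x| `^ r)%:E = nf%:E)%E ->
    (\int[mu]_(x in Rpos) (`|g x| `^ r)%:E = ng%:E)%E ->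
    (\int[mu]_(x in Rpos) (`|h x `^ sigma * u x| `^ r)%:E <=
      (C * (nf + ng))%:E)%E.
Proof.
move=> r1 asr.
have r0 : 0 < r by exact: lt_le_trans r1.
have [d [c0 [c1 [d0 c00 c10 Hd Hc]]]] := constants.
pose m := d / 2.
have m0 : 0 < m by rewrite divr_gt0.
have md : m <= d by rewrite ler_pdivrMr// mulr_natr mulr2n lerDl ltW.
have dm0 : 0 < d - m.
  by rewrite subr_gt0 ltr_pdivrMr// mulr_natr mulr2n ltrDl.
pose kappa := beta + r^-1.
have k0 : 0 < kappa by rewrite /kappa /beta; lra.
have bE : beta = kappa - r^-1 by rewrite /kappa addrK.
have kc0 : 0 < kappa * c0 by rewrite mulr_gt0.
have [B B0 HB] := weight_bounded (- beta - 1) m0 md.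
pose A := 2 `^ r * (h m `^ (kappa * r) / (kappa * r * c0)).
pose C1 := A * B `^ r.
pose C2 := 2 `^ r * ((kappa * c0)^-1 `^ (r - 1) * (kappa * c0)^-1).
have A0 : 0 <= A by rewrite !mulr_ge0 ?powR_ge0 ?invr_ge0 ?mulr_ge0 ?ltW.
have C10 : 0 <= C1 by rewrite mulr_ge0 ?powR_ge0.
have C20 : 0 <= C2 by rewrite !mulr_ge0 ?powR_ge0 ?invr_ge0 ?ltW.
pose K1 := C1 / (d - m).
have K10 : 0 <= K1 by rewrite divr_ge0// ltW.
pose K3 := c1 `^ (- r).
have K30 : 0 <= K3 by exact: powR_ge0.
exists (K1 + C2 + K3); first by rewrite !addr_ge0.
move=> u g lu rep Lg nf ng nfE ngE.
have mR : measurable (Rpos : set borel) by exact: measurable_Rpos.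
have r1e : (1 <= r%:E)%E by rewrite lee_fin.
have ig a b : 0 < a -> mu.-integrable `[a, b] (EFin \o g).
  by move=> a0; exact: Lp_pos_integrable_itv Lg a0.
have ing a : 0 < a -> mu.-integrable `[a, d] (EFin \o (fun t => `|g t|)).
  by move=> a0; have := integrable_norm (ig a d a0).
have [E EE HE] := increment_bound lu ig rep.
pose v x := h x `^ sigma * u x; pose f x := h x `^ (sigma + 1) * u x.
pose w x := h x `^ alpha * u x.
have mv := measurable_normpow r (measurable_weightM lu sigma);
  have mf := measurable_normpow r (measurable_weightM lu (sigma + 1)).
have mg : measurable_fun (Rpos : set borel) g by have /Lp_posP[] := Lg.
have mgr := measurable_normpow r mg.
have nf0 : 0 <= nf by rewrite -lee_fin -nfE; apply: integral_ge0 => x _;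
  rewrite lee_fin powR_ge0.
have ng0 : 0 <= ng by rewrite -lee_fin -ngE; apply: integral_ge0 => x _;
  rewrite lee_fin powR_ge0.
have subint (D : set borel) (F : R -> R) : measurable D -> D `<=` Rpos ->
    measurable_fun (Rpos : set borel) (fun x => (F x)%:E) -> (forall x, 0 <= F x) ->
    (\int[mu]_(x in D) (F x)%:E <= \int[mu]_(x in Rpos) (F x)%:E)%E.
  move=> mD DR mF F0; apply: ge0_subset_integral => // x _.
  by rewrite lee_fin.
have near0 (e : R) : 0 < e -> e <= m ->
    (\int[mu]_(x in `[e, m]) (`|v x| `^ r)%:E <= (K1 * nf + C2 * ng)%:E)%E.
  move=> e0 em.
  have sem := @itv_sub_Rpos R e m e0; have smd := @itv_sub_Rpos R m d m0.
  set X := (X in (X <= _)%E).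
  have X0 : (0 <= X)%E by apply: integral_ge0 => x _; rewrite lee_fin powR_ge0.
  have Xy y : E y -> m <= y <= d -> (X <= C1%:E * (`|f y| `^ r)%:E + (C2 * ng)%:E)%E.
    move=> Ey /andP[my yd]; have y0 : 0 < y by exact: lt_le_trans my.
    have mw : measurable_fun (`[e, m] : set borel) w.
      by apply: measurable_funS (measurable_weightM lu alpha).
    have NZ := @near_zero_Lp R h (half_derive h) d c0 c00 hpos dh cdh Hd m md E w
      (fun t => `|g t|) EE (fun t => normr_ge0 (g t)) ing beta HE r kappa e y
      r1 k0 bE e0 em mw my yd Ey.
    have -> : X = (\int[mu]_(x in `[e, m]) ((h x `^ beta * `|w x|) `^ r)%:E)%E.
      apply: eq_integral => x /set_mem /sem; rewrite RposE => x0.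
      by rewrite /v vE// normrM [X in X * _]ger0_norm ?powR_ge0.
    apply: (le_trans NZ); apply: leeD.
      rewrite -EFinM -[leRHS]EFinM lee_fin -/A /C1 -(mulrA A) ler_wpM2l//.
      rewrite -powRM ?normr_ge0//; apply: ge0_ler_powR;
        rewrite ?nnegrE ?mulr_ge0 ?(ltW r0)//.
      rewrite /w wE// normrM [X in X * _]ger0_norm ?powR_ge0//.
      by rewrite ler_wpM2r// HB// my.
    rewrite -/C2 (EFinM C2); apply: lee_wpmul2l; first by rewrite lee_fin.
    by rewrite -ngE; apply: subint => //; exact: itv_sub_Rpos.
  have : (X * (d - m)%:E <= (C1 * nf + C2 * ng * (d - m))%:E)%E.
    have mmd : mu `[m, d]%classic = (d - m)%:E.
      rewrite lebesgue_measure_itv/= lte_fin ifT ?EFinB//.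
      by rewrite -subr_gt0.
    rewrite -mmd -integral_cst//.
    apply: (@le_trans _ _ (\int[mu]_(y in `[m, d])
        (C1%:E * (`|f y| `^ r)%:E + (C2 * ng)%:E))%E).
      apply: ae_ge0_le_integral => //.
      - move=> y _; apply: adde_ge0;
          first by rewrite -EFinM lee_fin mulr_ge0// powR_ge0.
        by rewrite lee_fin mulr_ge0.
      - apply: emeasurable_funD => //; apply: measurable_funeM.
        exact: measurable_funS mf.
      move: EE; apply: filterS; first exact: (ae_filter_ringOfSetsType mu).
      by move=> y Ey /=; rewrite in_itv/=; exact: Xy.
    rewrite ge0_integralD//; last 3 first.
    - by move=> y _; rewrite -EFinM lee_fin mulr_ge0// powR_ge0.
    - by apply: measurable_funeM; exact: measurable_funS mf.
    - by move=> y _; rewrite lee_fin mulr_ge0.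
    rewrite EFinD; apply: leeD; last by rewrite integral_cst// [in leRHS]EFinM -mmd.
    rewrite ge0_integralZl//; last exact: measurable_funS mf.
    rewrite (EFinM C1); apply: lee_wpmul2l => //; rewrite -nfE.
    exact: subint.
  rewrite -lee_pdivlMr// => /le_trans; apply.
  rewrite -EFinM lee_fin /K1.
  rewrite le_eqVlt; apply/orP; left; apply/eqP; field.
  by rewrite gt_eqF.
have Rsplit : (Rpos : set R) = `]0, m]%classic `|` `]m, +oo[%classic.
  by rewrite /Rpos -itv_bndbnd_setU// bnd_simp ltW.
rewrite [X in (\int[mu]_(x in X) _ <= _)%E]Rsplit ge0_integral_setU; last 5 first.
- exact: measurable_itv.
- exact: measurable_itv.
- by move: mv; rewrite Rsplit; exact.
- by move=> x _; rewrite lee_fin powR_ge0.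
- apply/disj_setPS => x [/=]; rewrite !in_itv/= => /andP[_ xm] /andP[].
  by rewrite ltNge xm.
have -> : ((K1 + C2 + K3) * (nf + ng) = (K1 * nf + C2 * ng) + K3 * nf +
   (K1 * ng + C2 * nf + K3 * ng))%R by ring.
rewrite EFinD; apply: (@le_trans _ _ ((K1 * nf + C2 * ng + K3 * nf)%:E)); last first.
  by rewrite leeDl// lee_fin !addr_ge0// mulr_ge0.
rewrite EFinD; apply: leeD.
  (* The interval ]0, m] is exhausted by intervals bounded away from 0. *)
  pose F (n : nat) := `[m / n.+1%:R, m]%classic : set borel.
  have UF : `]0, m]%classic = \bigcup_n F n.
    apply/seteqP; split => [x /=|x [n _] /=]; rewrite !in_itv/=.
      move=> /andP[x0 xm]; exists (Num.truncn (m / x)) => //.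
      rewrite /F/= in_itv/= xm andbT.
      by rewrite ler_pdivrMr// mulrC -ler_pdivrMr// ltW// truncnS_gt.
    rewrite /F/= in_itv/= => /andP[nx ->]; rewrite andbT; apply: lt_le_trans nx.
    by rewrite divr_gt0.
  rewrite UF; set Y := (X in (_ <= X)%E).
  have sF n : F n `<=` Rpos by apply: itv_sub_Rpos; rewrite divr_gt0.
  have cF := @ge0_nondecreasing_set_cvg_integral _ borel R F
    (fun x => (`|h x `^ sigma * u x| `^ r)%:E) mu.
  apply: (cvge_le _ (cF _ _ _ _)).
  - apply: nearW => n; apply: near0; first by rewrite divr_gt0.
    by rewrite ler_pdivrMr// ler_peMr ?(ltW m0)// ler1n.
  - move=> n k nk; rewrite subsetEset; apply: subset_itvr; rewrite bnd_simp.
    by rewrite ler_wpM2l ?(ltW m0)// lef_pV2 ?posrE// ler_nat.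
  - by move=> n; exact: measurable_itv.
  - by move=> n; exact: measurable_funS mv.
  - by move=> n x _; rewrite lee_fin powR_ge0.
have sm : `]m, +oo[%classic `<=` (Rpos : set R).
  by move=> x /=; rewrite RposE in_itv/= andbT; exact: lt_trans.
apply: (@le_trans _ _ (\int[mu]_(x in `]m, +oo[) (K3%:E * (`|f x| `^ r)%:E))%E).
  apply: ge0_le_integral.
  - exact: measurable_itv.
  - by move=> x _; rewrite lee_fin powR_ge0.
  - exact: measurable_funS mv.
  - by apply: measurable_funeM; exact: measurable_funS mf.
  move=> x /[dup] /sm; rewrite RposE /= in_itv/= andbT => x0 mx.
  rewrite -EFinM lee_fin /K3 powRN -powR_inv1 ?powR_ge0// powRAC powR_inv1 ?(ltW c10)//.
  rewrite -powRM ?normr_ge0 ?invr_ge0 ?(ltW c10)//.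
  apply: ge0_ler_powR; rewrite ?nnegrE ?mulr_ge0 ?invr_ge0 ?(ltW r0) ?(ltW c10)//.
  by rewrite ler_pdivlMl// weight_shift// Hc// ltW.
rewrite ge0_integralZl; last 4 first.
- exact: measurable_itv.
- exact: measurable_funS mf.
- by move=> x _; rewrite lee_fin powR_ge0.
- by rewrite lee_fin.
rewrite (EFinM K3); apply: lee_wpmul2l => //; rewrite -nfE.
exact: subint.
Qed.

Lemma weighted_estimate_Lp (r : R) : 1 <= r -> alpha - r^-1 < sigma ->
  exists C : R, forall u g : R -> R,
    locally_integrable Rpos u ->
    distr_represents
      (distr_mul (fun x => h x `^ sigma) (Dalpha alpha h u)) g ->
    Lp_pos r%:E g ->
    Lp_pos r%:E (fun x => h x `^ (sigma + 1) * u x) ->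
    Lp_pos r%:E (fun x => h x `^ sigma * u x) /\
    (Lp_norm_pos r%:E (fun x => (h x `^ sigma * u x)%R) <=
       C%:E * (Lp_norm_pos r%:E g +
               Lp_norm_pos r%:E (fun x => (h x `^ (sigma + 1) * u x)%R)))%E.
Proof.
move=> r1 asr; have r0 : 0 < r by exact: lt_le_trans r1.
have [C C0 HC] := power_integral_estimate r1 asr.
exists ((C * 2) `^ r^-1) => u g lu rep Lg Lf.
have fin f : Lp_pos r%:E f -> exists2 a : R, 0 <= a &
    Lp_norm_pos r%:E f = a%:E /\ (\int[mu]_(x in Rpos) (`|f x| `^ r)%:E =
      (a `^ r)%:E)%E.
  move=> /Lp_posP[_ ff]; have nn : (0 <= Lp_norm_pos r%:E f)%E by exact: Lnorm_ge0.
  have E : Lp_norm_pos r%:E f = (fine (Lp_norm_pos r%:E f))%:E.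
    by rewrite fineK// ge0_fin_numE.
  exists (fine (Lp_norm_pos r%:E f)); first exact: fine_ge0.
  by split=> //; rewrite -Lp_norm_pos_powR ?gt_eqF// E.
have [a a0 [aE aI]] := fin _ Lg.
have [b b0 [bE bI]] := fin _ Lf.
have := HC u g lu rep Lg _ _ bI aI.
rewrite -Lp_norm_pos_powR ?gt_eqF//.
set n := Lp_norm_pos r%:E (fun x => h x `^ sigma * u x) => nC.
have n0 : (0 <= n)%E by exact: Lnorm_ge0.
have nle : (n <= ((C * 2) `^ r^-1 * (a + b))%:E)%E.
  have ab : C * (b `^ r + a `^ r) <= ((C * 2) `^ r^-1 * (a + b)) `^ r.
    rewrite powRM ?addr_ge0 ?powR_ge0// -powRrM mulVf ?gt_eqF// powRr1 ?mulr_ge0//.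
    rewrite -mulrA ler_wpM2l// mulr_natl mulr2n.
    by apply: lerD; apply: ge0_ler_powR;
      rewrite ?nnegrE ?addr_ge0 ?(ltW r0)// ?lerDl ?lerDr.
  case: (n) n0 nC => [x| |//]; last by rewrite /= gt_eqF// leye_eq.
  rewrite !lee_fin => x0 /le_trans /(_ ab) xr.
  rewrite leNgt; apply/negP => lt.
  have := @gt0_ltr_powR R r r0 ((C * 2) `^ r^-1 * (a + b)) x.
  rewrite !nnegrE mulr_ge0 ?powR_ge0 ?addr_ge0// => /(_ isT x0 lt).
  by rewrite ltNge xr.
split; last by rewrite aE bE -EFinD -EFinM.
apply/Lp_posP; split; first exact: measurable_weightM.
by apply: (le_lt_trans nle); rewrite ltry.
Qed.

Lemma weighted_estimate_Linfty : alpha < sigma ->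
  exists C : R, forall u g : R -> R,
    locally_integrable Rpos u ->
    distr_represents
      (distr_mul (fun x => h x `^ sigma) (Dalpha alpha h u)) g ->
    Lp_pos +oo%E g ->
    Lp_pos +oo%E (fun x => h x `^ (sigma + 1) * u x) ->
    Lp_pos +oo%E (fun x => h x `^ sigma * u x) /\
    (Lp_norm_pos +oo (fun x => (h x `^ sigma * u x)%R) <=
       C%:E * (Lp_norm_pos +oo g +
               Lp_norm_pos +oo (fun x => (h x `^ (sigma + 1) * u x)%R)))%E.
Proof.
move=> asr.
have [d [c0 [c1 [d0 c00 c10 Hd Hc]]]] := constants.
pose m := d / 2.
have m0 : 0 < m by rewrite divr_gt0.
have md : m < d by rewrite ltr_pdivrMr// mulr_natr mulr2n ltrDl.
have b0 : 0 < beta by rewrite /beta subr_gt0.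
have [B B0 HB] := weight_bounded (- beta - 1) m0 (ltW md).
pose K1 := h m `^ beta * B; pose K2 := (beta * c0)^-1; pose K3 := c1^-1.
have K10 : 0 <= K1 by rewrite mulr_ge0 ?powR_ge0.
have K20 : 0 <= K2 by rewrite invr_ge0 mulr_ge0 ?ltW.
have K30 : 0 <= K3 by rewrite invr_ge0 ltW.
exists (K1 + K2 + K3) => u g lu rep Lg Lf.
have fin f : Lp_pos +oo%E f -> exists2 a : R, 0 <= a & Lp_norm_pos +oo%E f = a%:E.
  move=> /Lp_posP[_ ff]; have nn : (0 <= Lp_norm_pos +oo%E f)%E by exact: Lnorm_ge0.
  by exists (fine (Lp_norm_pos +oo%E f)); rewrite ?fine_ge0// fineK// ge0_fin_numE.
have [a a0 aE] := fin _ Lg.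
have [b b0' bE] := fin _ Lf.
have ga : {ae mu, forall x, 0 < x -> `|g x| <= a} by apply: Linfty_ae_le; rewrite aE.
have fb : {ae mu, forall x, 0 < x -> `|h x `^ (sigma + 1) * u x| <= b}.
  by apply: Linfty_ae_le; rewrite bE.
have ig x y : 0 < x -> mu.-integrable `[x, y] (EFin \o g).
  by move=> x0; apply: Lp_pos_integrable_itv Lg x0; rewrite leey.
have ing x : 0 < x -> mu.-integrable `[x, d] (EFin \o (fun t => `|g t|)).
  by move=> x0; have := integrable_norm (ig x d x0).
have [E EE HE] := increment_bound lu ig rep.
(* The interval [m, d] is not negligible, so that it contains a point y at which
   all the bounds that hold almost everywhere are available. *)
have [y [ymd Ey fy]] : exists y, [/\ m <= y <= d, E y &
    `|h y `^ (sigma + 1) * u y| <= b].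
  apply: contrapT => none.
  have : mu.-negligible `[m, d]%classic.
    apply: negligibleS (negligibleU EE fb) => y /=; rewrite in_itv/= => ymd.
    have y0 : 0 < y by move: ymd => /andP[+ _]; exact: lt_le_trans.
    have [Ey|] := pselect (E y); [right => H|by left].
    by apply: none; exists y; split => //; exact: H.
  have mmd : measurable (`[m, d] : set borel) by exact: measurable_itv.
  have mud : mu `[m, d]%classic = (d - m)%:E.
    by rewrite lebesgue_measure_itv/= lte_fin md EFinB.
  move=> /(negligibleP mu mmd) mud0; move: mud; rewrite mud0 => -[] /eqP.
  by rewrite eq_sym subr_eq0 gt_eqF.
have [my yd] := andP ymd; have y0 : 0 < y by exact: lt_le_trans my.
have vle : {ae mu, forall x, 0 < x -> `|h x `^ sigma * u x| <=
  (K1 + K2 + K3) * (a + b)}.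
  move: EE fb; apply: filterS2; first exact: (ae_filter_ringOfSetsType mu).
  move=> x Ex fx x0.
  have [xm|mx] := leP x m.
    rewrite vE// normrM [X in X * _]ger0_norm ?powR_ge0//.
    apply: (le_trans (@near_zero_Linfty R h (half_derive h) d c0 c00 hpos dh cdh Hd m
      (ltW md) E (fun x => h x `^ alpha * u x) (fun t => `|g t|)
      (fun t => normr_ge0 (g t)) ing beta HE a x y b0 a0 ga x0 xm my yd Ex Ey)).
    have wy : `|h y `^ alpha * u y| <= B * b.
      rewrite wE// normrM [X in X * _]ger0_norm ?powR_ge0//.
      by apply: ler_pM; rewrite ?powR_ge0// HB.
    have : h m `^ beta * `|h y `^ alpha * u y| <= K1 * b.
      by rewrite -mulrA ler_wpM2l ?powR_ge0.
    move=> /lerD/(_ (lexx (a / (beta * c0))))/le_trans; apply.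
    rewrite -/K2 !mulrDl !mulrDr [a * K2]mulrC.
    have := mulr_ge0 K10 a0; have := mulr_ge0 K20 b0'.
    have := mulr_ge0 K30 a0; have := mulr_ge0 K30 b0'.
    by move=> ? ? ? ?; lra.
  have hx0 := hpos x0.
  have : `|h x `^ sigma * u x| <= K3 * b.
    rewrite ler_pdivlMl//; apply: le_trans (fx x0).
    by rewrite weight_shift// Hc// ltW.
  move=> /le_trans; apply; rewrite !mulrDl !mulrDr.
  have := mulr_ge0 K10 a0; have := mulr_ge0 K20 a0; have := mulr_ge0 K10 b0'.
  have := mulr_ge0 K30 a0; have := mulr_ge0 K20 b0'.
  by move=> ? ? ? ? ?; lra.
have nle : (Lp_norm_pos +oo%E (fun x => (h x `^ sigma * u x)%R) <=
    ((K1 + K2 + K3) * (a + b))%:E)%E.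
  by apply: Linfty_norm_le vle; rewrite mulr_ge0 ?addr_ge0.
split; last by rewrite aE bE -EFinD -EFinM.
apply/Lp_posP; split; first exact: measurable_weightM.
by apply: (le_lt_trans nle); rewrite ltry.
Qed.

End WeightedEstimate.

Unset Implicit Arguments.
Set Strict Implicit.
Set Printing Implicit Defensive.

Theorem proposition5p1 (R : realType) (p : \bar R) (alpha sigma : R)
    (h : R -> R)
    (hp : (1 <= p)%E)
    (hsigma : (alpha%:E - p^-1 < sigma%:E)%E)
    (hC1 : C1_half h)
    (hbdd : Lp_pos +oo%E h)
    (h0 : h 0 = 0)
    (dh0 : 0 < half_derive h 0)
    (hpos : forall x : R, 0 < x -> 0 < h x)
    (hliminf : (0 < limf_einf (EFin \o h) (pinfty_nbhs R))%E) :
  exists C : R, forall u g : R -> R,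
    locally_integrable Rpos u ->
    (* g is the function h^sigma D_alpha u *)
    distr_represents
      (distr_mul (fun x => h x `^ sigma) (Dalpha alpha h u)) g ->
    Lp_pos p g ->
    Lp_pos p (fun x => h x `^ (sigma + 1) * u x) ->
    Lp_pos p (fun x => h x `^ sigma * u x) /\
    (Lp_norm_pos p (fun x => (h x `^ sigma * u x)%R) <=
       C%:E * (Lp_norm_pos p g +
               Lp_norm_pos p (fun x => (h x `^ (sigma + 1) * u x)%R)))%E.
Proof.
case: p hp hsigma => [r| |//] hp hsigma.
  rewrite lee_fin in hp; have r0 : 0 < r by exact: lt_le_trans hp.
  apply: weighted_estimate_Lp => //.
  by move: hsigma; rewrite inver gt_eqF// -EFinB lte_fin.
apply: weighted_estimate_Linfty => //.
by move: hsigma; rewrite invey sube0 lte_fin.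
Qed.
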